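(* For $\gamma\in(0,1)$ let $$\phi(\gamma):=\sup\Big\{\int_{[0,1]^2}H(W(x,y))\,dx\,dy\;:\;W\in\mathcal{W},\ \int_{[0,1]^2}W=\gamma,\ t_{\mathrm{ind}}(K_{1,3},W)=0\Big\}\,.$$ Then for all $\gamma\in(0,1)$ we have $\phi(\gamma)=r^\ast(\gamma)$, where $r^\ast(\gamma)=\frac{5+\sqrt{5}}{10}H\big(\frac{3-\sqrt{5}}{2}\big)\gamma$ for $\gamma\in\big[0,\frac{5-\sqrt{5}}{4}\big)$ and $r^\ast(\gamma)=\frac12H(2\gamma-1)$ for $\gamma\in\big[\frac{5-\sqrt{5}}{4},1\big]$. Moreover, for every $\gamma\in\big[\frac{5-\sqrt{5}}{4},1\big)$ there is a unique graphon up to equivalence achieving the supremum $\phi(\gamma)$, and for every $\gamma\in\big(0,\frac{5-\sqrt{5}}{4}\big)$ there are infinitely many pairwise nonequivalent graphons achieving $\phi(\gamma)$.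
   Context: A graphon is a measurable function $W:[0,1]^2\to[0,1]$ with $W(x,y)=W(y,x)$; $\mathcal{W}$ is the set of graphons. $H(x)=-x\log_2x-(1-x)\log_2(1-x)$ with $0\log_20=0$. The induced claw density is $t_{\mathrm{ind}}(K_{1,3},W)=\int_{[0,1]^4}\big(\prod_{i=2}^4W(x_1,x_i)\big)\big(\prod_{2\le i<j\le4}(1-W(x_i,x_j))\big)\,dx_1dx_2dx_3dx_4$. For a finite graph $F$, $t(F,W)=\int_{[0,1]^{V(F)}}\prod_{uv\in E(F)}W(x_u,x_v)\prod_{u}dx_u$. Two graphons $W_1,W_2$ are equivalent if $t(F,W_1)=t(F,W_2)$ for every finite simple graph $F$. *)

(* Defs.v *)
From HB Require Import structures.
From mathcomp Require Import all_boot all_order all_algebra.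
From mathcomp Require Import all_classical all_reals all_analysis.
Set Implicit Arguments.
Unset Strict Implicit.
Unset Printing Implicit Defensive.
Import Order.TTheory GRing.Theory Num.Theory.
Import numFieldNormedType.Exports.
Local Open Scope classical_set_scope.
Local Open Scope ring_scope.

Section tuple_lebesgue.
Variable R : realType.
Local Notation mR := (measurableTypeR R).
Local Open Scope ereal_scope.

Definition cons_pair n (p : R * n.-tuple mR) : n.+1.-tuple mR :=
  [the n.+1.-tuple mR of p.1 :: p.2].

Lemma measurable_cons_pair n : measurable_fun setT (@cons_pair n).
Proof. by apply: measurable_cons. Qed.

Definition uncons_pair n (x : n.+1.-tuple mR) : mR * n.-tuple mR :=
  (thead x, [tuple of behead x]).

Lemma measurable_uncons_pair n : measurable_fun setT (@uncons_pair n).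
Proof.
apply: measurable_fun_pair; last exact: measurable_behead.
exact: (measurable_tnth ord0).
Qed.

Lemma cons_pairK n : cancel (@cons_pair n) (@uncons_pair n).
Proof.
move=> [a t]; rewrite /uncons_pair /cons_pair theadE/=; congr pair.
exact/val_inj.
Qed.

Section step.
Variables (n : nat) (m : {sigma_finite_measure set (n.-tuple mR) -> \bar R}).

Definition lebesgue_cons : set (n.+1.-tuple mR) -> \bar R :=
  pushforward (@lebesgue_measure R \x m) (@cons_pair n).

Let lebesgue_cons0 : lebesgue_cons set0 = 0.
Proof. by rewrite /lebesgue_cons /pushforward preimage_set0 measure0. Qed.

Let lebesgue_cons_ge0 A : 0 <= lebesgue_cons A.
Proof. exact: (@measure_ge0 _ _ _ (@lebesgue_measure R \x m)). Qed.

Let lebesgue_cons_sigma_additive : semi_sigma_additive lebesgue_cons.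
Proof.
move=> F mF tF mUF; rewrite /lebesgue_cons /pushforward preimage_bigcup.
have mp A : measurable A -> measurable (@cons_pair n @^-1` A).
  by move=> mA; rewrite -[X in measurable X]setTI; exact: measurable_cons_pair.
apply: (@measure_semi_sigma_additive _ _ _ (@lebesgue_measure R \x m)).
- by move=> k; exact: mp.
- apply/trivIsetP => /= i j _ _ ij; rewrite -preimage_setI.
  by move/trivIsetP : tF => /(_ _ _ _ _ ij) ->//; rewrite preimage_set0.
- by rewrite -preimage_bigcup; exact: mp.
Qed.

HB.instance Definition _ := isMeasure.Build _ _ _ lebesgue_cons
  lebesgue_cons0 lebesgue_cons_ge0 lebesgue_cons_sigma_additive.

Let lebesgue_cons_sigma_finite : sigma_finite setT lebesgue_cons.
Proof.
have /sigma_finiteP[F [TF ndF Foo]] := sigma_finiteT (@lebesgue_measure R).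
have /sigma_finiteP[G [TG ndG Goo]] := sigma_finiteT m.
exists (fun k => @uncons_pair n @^-1` (F k `*` G k)).
  rewrite -preimage_bigcup (_ : \bigcup_k _ = setT) ?preimage_setT//.
  rewrite -subTset => -[x y] _.
  have [i _ Fix] : (\bigcup_k F k) x by rewrite -TF.
  have [j _ Gjy] : (\bigcup_k G k) y by rewrite -TG.
  exists (maxn i j) => //; split => /=.
    by move: x Fix; exact/subsetPset/ndF/leq_maxl.
  by move: y Gjy; exact/subsetPset/ndG/leq_maxr.
move=> k; have [mF Fk] := Foo k; have [mG Gk] := Goo k.
have mFG : measurable (F k `*` G k) by exact: measurableX.
split.
  by rewrite -[X in measurable X]setTI; exact: measurable_uncons_pair.
rewrite /lebesgue_cons /pushforward -comp_preimage.
have -> : (@uncons_pair n \o @cons_pair n) @^-1` (F k `*` G k) = F k `*` G k.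
  by rewrite (_ : _ \o _ = idfun)//; apply/funext => p; exact: cons_pairK.
by rewrite product_measure1E// lte_mul_pinfty// ge0_fin_numE.
Qed.

HB.instance Definition _ := Measure_isSigmaFinite.Build _ _ _ lebesgue_cons
  lebesgue_cons_sigma_finite.

End step.

(* Lebesgue measure on R^n: the n-fold product of lebesgue_measure, carried
   along (x, (y_1, ..., y_k)) |-> (x, y_1, ..., y_k). *)
Fixpoint tuple_lebesgue n : {sigma_finite_measure set (n.-tuple mR) -> \bar R} :=
  match n with
  | 0 => \d_([tuple] : 0.-tuple mR)
  | k.+1 => lebesgue_cons (tuple_lebesgue k)
  end.

End tuple_lebesgue.

Section graphons.
Variable R : realType.
Local Notation mR := (measurableTypeR R).

Definition unit_interval : set mR := [set` `[0 : R, 1 : R]].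

Definition unit_square : set (mR * mR) := unit_interval `*` unit_interval.

Definition unit_cube n : set (n.-tuple mR) :=
  [set x | forall i, unit_interval (tnth x i)].

(* Only the values on the unit square are meaningful: those elsewhere are
   unconstrained, and no definition below depends on them. *)
Record graphon := Graphon {
  graphon_fun :> mR * mR -> R;
  measurable_graphon : measurable_fun unit_square graphon_fun;
  graphon_sym : forall x y, unit_square (x, y) ->
    graphon_fun (x, y) = graphon_fun (y, x);
  graphon_itv : forall p, unit_square p -> 0 <= graphon_fun p <= 1
}.

Record sgraph := SGraph {
  vertex :> finType;
  adj : rel vertex;
  adj_sym : symmetric adj;
  adj_irrefl : irreflexive adj
}.

Definition log2 (x : R) : R := ln x / ln 2.

(* 0 log2 0 = 0 holds since ln 0 = 0 in the library. *)
Definition binary_entropy (x : R) : R := - x * log2 x - (1 - x) * log2 (1 - x).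

Local Open Scope ereal_scope.

Definition leb2 := @lebesgue_measure R \x @lebesgue_measure R.

Definition edge_density (W : graphon) : \bar R :=
  \int[leb2]_(p in unit_square) (W p)%:E.

Definition entropy (W : graphon) : \bar R :=
  \int[leb2]_(p in unit_square) (binary_entropy (W p))%:E.

(* The coordinate of the vertex u is the one of index enum_rank u; comparing
   ranks makes each edge contribute exactly one factor. *)
Definition hom_density (F : sgraph) (W : graphon) : \bar R :=
  \int[@tuple_lebesgue R #|F|]_(x in @unit_cube #|F|)
    (\prod_(e : F * F | adj e.1 e.2 && (enum_rank e.1 < enum_rank e.2)%N)
       W (tnth x (enum_rank e.1), tnth x (enum_rank e.2)))%:E.

(* The center of the claw is the coordinate of index 0. *)
Definition claw_density (W : graphon) : \bar R :=
  \int[@tuple_lebesgue R 4]_(x in @unit_cube 4)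
    ((\prod_(i < 4 | (0 < i)%N) W (tnth x ord0, tnth x i)) *
     \prod_(i < 4 | (0 < i)%N) \prod_(j < 4 | (i < j)%N)
        (1 - W (tnth x i, tnth x j)))%R%:E.

Definition equivalent (W1 W2 : graphon) : Prop :=
  forall F : sgraph, hom_density F W1 = hom_density F W2.

Definition feasible (gamma : R) : set graphon :=
  [set W | edge_density W = gamma%:E /\ claw_density W = 0].

Definition phi (gamma : R) : \bar R :=
  ereal_sup [set entropy W | W in feasible gamma].

Definition achieves (gamma : R) (W : graphon) : Prop :=
  feasible gamma W /\ entropy W = phi gamma.

Local Close Scope ereal_scope.

Definition gamma0 : R := (5 - Num.sqrt 5) / 4.

Definition rstar (gamma : R) : R :=
  if gamma < gamma0
  then (5 + Num.sqrt 5) / 10 * binary_entropy ((3 - Num.sqrt 5) / 2) * gamma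
  else 2^-1 * binary_entropy (2 * gamma - 1).

End graphons.

(* Main.v *)
Require Import Defs.
From HB Require Import structures.
From mathcomp Require Import all_boot all_order all_algebra.
From mathcomp Require Import zify ring lra measurable_realfun.
From mathcomp Require Import all_classical all_reals all_analysis.
Set Implicit Arguments.
Unset Strict Implicit.
Unset Printing Implicit Defensive.
Import Order.TTheory GRing.Theory Num.Theory.
Import numFieldNormedType.Exports.
Local Open Scope classical_set_scope.
Local Open Scope ring_scope.

(** Call a pair gray if [0 < W < 1] and black if [W = 1]. If [x] forms gray
pairs with [y] and with [z], and [y z] is not black, then the set of all such
[x] is null: two of its points are nonadjacent, since together with [y] and [z]
they would form a claw centred at one of them, and then three of its points
form a claw centred at [y]. So gray neighbourhoods are black cliques, whence
[g x <= b y] for almost every gray pair, [g] and [b] being the gray and black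
degrees. Integrating [b x / g x + b y / g y >= 2] over the gray pairs shows
that the gray pairs have measure [m] at most the measure [o] of the black ones.

The entropy lives on the gray pairs, where Gibbs' inequality bounds [H(W)] by
an affine function of [W] that is exact at the conjectured optimal value [q].
Together with [m <= o] and [m + o <= 1] this gives the upper bound. In case of
equality for [gamma >= gamma0], [W = q] on the gray pairs and [m = o = 1/2], so
the gray graph is extremal for Mantel's theorem, i.e., complete bipartite with
equal parts. For [gamma < gamma0] one may distribute the mass over two disjoint
copies of the extremal structure, of sizes [a] and [b] with [a^2 + b^2] fixed;
the triangle density tells them apart. *)

(** * Almost everywhere statements in product spaces *)

(* The library proves that [m1 \x m2] is sigma-finite, under the generated name
   used below, but does not infer the corresponding structure. *)
Section prod_measure.
Context d1 d2 (T1 : measurableType d1) (T2 : measurableType d2) (R : realType).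
Variables (m1 : {sigma_finite_measure set T1 -> \bar R}).
Variables (m2 : {sigma_finite_measure set T2 -> \bar R}).

Definition prod_measure : set (T1 * T2) -> \bar R := (m1 \x m2)%E.

HB.instance Definition _ := Measure.on prod_measure.

Let prod_measure_sigma_finite : sigma_finite setT prod_measure.
Proof.
by have [] :=
  lebesgue_integral_fubini.measure_function_Measure_isSigmaFinite__to__measure_function_isSigmaFinite m1 m2.
Qed.

HB.instance Definition _ := Measure_isSigmaFinite.Build _ _ _ prod_measure
  prod_measure_sigma_finite.

End prod_measure.

Lemma ae_setP d (T : measurableType d) (R : realType)
    (m : {measure set T -> \bar R}) (P : set T) : measurable P ->
  {ae m, forall x, P x} <-> m (~` P) = 0%E.
Proof. by move=> mP; apply: negligibleP; exact: measurableC. Qed.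

Lemma ae_all d (T : measurableType d) (R : realType)
    (m : {measure set T -> \bar R}) (P : set T) :
  (forall x, P x) -> {ae m, forall x, P x}.
Proof. by move=> h; exact: filterE. Qed.

Lemma ae_imp d (T : measurableType d) (R : realType)
    (m : {measure set T -> \bar R}) (P Q : set T) :
  (forall x, P x -> Q x) -> {ae m, forall x, P x} -> {ae m, forall x, Q x}.
Proof. by move=> h; exact: filterS. Qed.

(** Turns almost sure claw-freeness into the choice of actual points: it supplies the vertices of a
    claw one after another from a set that is not null. *)
Lemma ae_ex d (T : measurableType d) (R : realType)
    (m : {measure set T -> \bar R}) (P A : set T) : measurable A ->
  {ae m, forall x, P x} -> m A != 0%E -> exists2 x, A x & P x.
Proof.
move=> mA aP; apply: contraNP => /forall2NP nE; apply/eqP/negligibleP => //.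
by apply: negligibleS aP => x Ax Px; case: (nE x).
Qed.

Section almost_everywhere_product.
Context d1 d2 (T1 : measurableType d1) (T2 : measurableType d2) (R : realType).
Variables (m1 : {sigma_finite_measure set T1 -> \bar R}).
Variables (m2 : {sigma_finite_measure set T2 -> \bar R}).
Variables (E : set (T1 * T2)) (mE : measurable E).
Local Open Scope ereal_scope.

Let xsE x : xsection (~` E) x = ~` [set y | E (x, y)].
Proof. by apply/seteqP; split=> y /=; rewrite /xsection/= inE. Qed.

Let ysE y : ysection (~` E) y = ~` [set x | E (x, y)].
Proof. by apply/seteqP; split=> x /=; rewrite /ysection/= inE. Qed.

Lemma measurable_slice1 x : measurable [set y | E (x, y)].
Proof.
rewrite (_ : [set y | _] = xsection E x); first exact: measurable_xsection.
by apply/seteqP; split=> y /=; rewrite /xsection/= inE.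
Qed.

Lemma measurable_slice2 y : measurable [set x | E (x, y)].
Proof.
rewrite (_ : [set x | _] = ysection E y); first exact: measurable_ysection.
by apply/seteqP; split=> x /=; rewrite /ysection/= inE.
Qed.

(** Lets Fubini be applied to nested almost-everywhere statements. The set is the zero set of the
    measurable function sending [x] to the measure of the section of the complement of [E]. *)
Lemma measurable_ae_section : measurable [set x | {ae m2, forall y, E (x, y)}].
Proof.
rewrite (_ : [set x | _] = setT `&` ((m2 \o xsection (~` E)) @^-1` [set 0])).
  by apply: measurable_fun_xsection => //; exact: measurableC.
rewrite setTI; apply/seteqP; split=> x /=; rewrite xsE;
  by move/(ae_setP m2 (measurable_slice1 x)).
Qed.

(** Fubini for null sets: the product measure of the complement of [E] is the integral of the
    measures of its sections, and a nonnegative integral vanishes exactly when its integrand does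
    almost everywhere. *)
Lemma ae_prodP : {ae m1 \x m2, forall z, E z} <->
  {ae m1, forall x, {ae m2, forall y, E (x, y)}}.
Proof.
rewrite (ae_setP _ mE) (ae_setP _ measurable_ae_section) /= /product_measure1.
have mf := measurable_fun_xsection m2 (measurableC mE).
rewrite (eq_integral (fun x => `|(m2 \o xsection (~` E)) x|)); last first.
  by move=> x _; rewrite gee0_abs.
rewrite (ae_eq_integral_abs _ measurableT mf) -(ae_setP _ measurable_ae_section).
split; apply: filterS => x /=; rewrite xsE.
  by move/(_ I) => h; apply/(ae_setP m2 (measurable_slice1 x)).
by move=> h _; apply/(ae_setP m2 (measurable_slice1 x)).
Qed.

Lemma ae_prod_swapP : {ae m1 \x m2, forall z, E z} <->
  {ae m2, forall y, {ae m1, forall x, E (x, y)}}.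
Proof.
rewrite (ae_setP _ mE).
(* The two iterated integrals agree on rectangles, hence on all measurable sets by uniqueness of the
   product measure. *)
have e : (m1 \x m2) (~` E) = (m1 \x^ m2) (~` E).
  apply: product_measure_unique => [A B mA mB|]; last exact: measurableC.
  exact: product_measure2E.
rewrite /= in e; rewrite /= e /product_measure2.

have mf := measurable_fun_ysection m1 (measurableC mE).
rewrite (eq_integral (fun x => `|(m1 \o ysection (~` E)) x|)); last first.
  by move=> x _; rewrite gee0_abs.
rewrite (ae_eq_integral_abs _ measurableT mf).
split; apply: filterS => y /=; rewrite ysE.
  by move/(_ I) => h; apply/(ae_setP m1 (measurable_slice2 y)).
by move=> h _; apply/(ae_setP m1 (measurable_slice2 y)).
Qed.

Lemma ae_swap : {ae m1, forall x, {ae m2, forall y, E (x, y)}} <->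
  {ae m2, forall y, {ae m1, forall x, E (x, y)}}.
Proof. by rewrite -ae_prodP ae_prod_swapP. Qed.

End almost_everywhere_product.

(** * Claw-free kernels *)

Lemma ae_subset_measure d (T : measurableType d) (R : realType)
    (m : {measure set T -> \bar R}) (A B : set T) :
  measurable A -> measurable B -> {ae m, forall x, A x -> B x} ->
  (m A <= m B)%E.
Proof.
move=> mA mB AB; rewrite -(setUIDK A B) measureU//; last 3 first.
- exact: measurableI.
- exact: measurableD.
- by rewrite setDE setIACA setICr setI0.
have d0 : m (A `\` B) = 0%E.
  apply/negligibleP; first exact: measurableD.
  by apply: negligibleS AB => x [Ax nBx] /(_ Ax).
rewrite [X in (_ + X)%E]d0 adde0.
by apply: le_measure; rewrite ?inE//; exact: measurableI.
Qed.

(** The measure of [B] equals that of [A], which is at most that of their intersection; finiteness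
    allows cancellation, leaving measure 0 for the part of [B] outside [A]. *)
Lemma ae_subset_sym d (T : measurableType d) (R : realType)
    (m : {measure set T -> \bar R}) (A B : set T) :
  measurable A -> measurable B -> m A = m B -> m A \is a fin_num ->
  {ae m, forall x, A x -> B x} -> {ae m, forall x, B x -> A x}.
Proof.
move=> mA mB AB Afin aeAB.
have AI : (m A <= m (B `&` A))%E.
  apply: ae_subset_measure => //; first exact: measurableI.
  by apply: filterS aeAB => x ABx Ax; split=> //; exact: ABx.
have mD : measurable (B `\` A) by exact: measurableD.
have d0 : m (B `\` A) = 0%E.
  apply/eqP; rewrite -measure_le0 -(@leeD2lE _ (m A))// adde0.
  rewrite {2}AB -[in leRHS](setUIDK B A) measureU//.
  - by rewrite leeD2r.
  - exact: measurableI.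
  - by rewrite setDE setIACA setICr setI0.
have := (negligibleP m mD).2 d0.
apply: negligibleS => x /= /not_implyP[Bx nAx].
by split.
Qed.

Section claw_free_kernel.
Context d (T : measurableType d) (R : realType).
Variable mu : {sigma_finite_measure set T -> \bar R}.
Local Notation mu2 := (prod_measure mu mu).
Variable w : T * T -> R.
Hypothesis mw : measurable_fun setT w.
Hypothesis w01 : forall p, 0 <= w p <= 1.
Hypothesis wC : forall x y, w (x, y) = w (y, x).

(** The integrand of the induced claw density, with centre [x] and leaves [a], [b], [c]. *)
Definition claw (x a b c : T) : R := w (x, a) * w (x, b) * w (x, c) *
  (1 - w (a, b)) * (1 - w (a, c)) * (1 - w (b, c)).

Hypothesis claw0 : {ae mu, forall x, {ae mu, forall a, {ae mu, forall b,
  {ae mu, forall c, claw x a b c = 0}}}}.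

Definition gray (x y : T) : bool := 0 < w (x, y) < 1.
Definition black (x y : T) : bool := w (x, y) == 1.

Lemma measurable_kernel_comp d' (S : measurableType d') (f g : S -> T) :
  measurable_fun setT f -> measurable_fun setT g ->
  measurable_fun setT (fun s => w (f s, g s)).
Proof.
by move=> mf mg; apply: (measurableT_comp mw); exact: measurable_fun_pair.
Qed.

Lemma measurable_gray d' (S : measurableType d') (f g : S -> T) :
  measurable_fun setT f -> measurable_fun setT g ->
  measurable [set s | gray (f s) (g s)].
Proof.
move=> mf mg; rewrite -[X in measurable X]setTI.
rewrite (_ : [set s | _] = (fun s => w (f s, g s)) @^-1` `]0, 1[%classic).
  exact: measurable_kernel_comp.
by apply/seteqP; split=> s /=; rewrite /gray in_itv.
Qed.

Lemma measurable_black d' (S : measurableType d') (f g : S -> T) :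
  measurable_fun setT f -> measurable_fun setT g ->
  measurable [set s | black (f s) (g s)].
Proof.
move=> mf mg; rewrite -[X in measurable X]setTI.
rewrite (_ : [set s | _] = (fun s => w (f s, g s)) @^-1` [set 1]).
  exact: measurable_kernel_comp.
by apply/seteqP; split=> s /= /eqP.
Qed.

Lemma grayC x y : gray x y = gray y x.
Proof. by rewrite /gray wC. Qed.

(** Let [A] be the set of common gray neighbours and suppose it is not null. For typical [x], [a] in
    [A] the claw with centre [x] and leaves [a], [y], [z] vanishes, and all its factors but
    [w (x, a)] are positive, so [w (x, a) = 0]. Three such points are then the leaves of a claw
    centred at [y] with positive weight. *)
Lemma common_gray_null y z :
  {ae mu, forall x, {ae mu, forall a, claw x a y z = 0}} ->
  {ae mu, forall a, {ae mu, forall b, {ae mu, forall c, claw y a b c = 0}}} ->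
  ~~ black y z -> {ae mu, forall x, ~ (gray x y /\ gray x z)}.
Proof.
move=> cx cy byz; pose A := [set x | gray x y /\ gray x z].
have mA : measurable A.
  by apply: measurableI; apply: measurable_gray.
apply/ae_setP; first exact: measurableC.
rewrite setCK; apply/eqP/negP => /negP A0.
have lt1 p : w p != 1 -> 0 < 1 - w p.
  by move=> wp; rewrite subr_gt0 lt_neqAle wp; case/andP: (w01 p).
have wyz := lt1 _ byz.
have nadj x a : A x -> A a -> claw x a y z = 0 -> w (x, a) = 0.
  move=> [/andP[xy0 xy1] /andP[xz0 xz1]] [/andP[ay0 ay1] /andP[az0 az1]] /eqP.
  have ay2 : 0 < 1 - w (a, y) by rewrite subr_gt0.
  have az2 : 0 < 1 - w (a, z) by rewrite subr_gt0.
  by rewrite /claw !mulf_eq0 !(gt_eqF xy0, gt_eqF xz0, gt_eqF ay2, gt_eqF az2,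
    gt_eqF wyz) !orbF => /eqP.
(* Each point is chosen outside the null sets attached to the points chosen before it, and so that
   the statements about the next points still hold almost everywhere. *)
have [x Ax [cx1 cy1]] := ae_ex mA (filterI cx cy) A0.
have [a Aa [/(nadj _ _ Ax Aa) xa0 [ca cy2]]] :=
  ae_ex mA (filterI cx1 (filterI cx cy1)) A0.
have [b Ab [/(nadj _ _ Ax Ab) xb0 [/(nadj _ _ Aa Ab) ab0]]] :=
  ae_ex mA (filterI cx1 (filterI ca cy2)) A0.
move/eqP; rewrite /claw xa0 xb0 ab0 subr0 !mulr1 !mulf_eq0 !(wC y).
case: Ax Aa Ab => /andP[xy _] _ [/andP[ay _] _] [/andP[b_y _] _].
by rewrite !gt_eqF.
Qed.

(** This is [common_gray_null] with [x] quantified first instead of last. The work lies in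
    exchanging quantifiers, which requires measurability of the sets involved. *)
Lemma gray_neighbours_black : {ae mu, forall x, {ae mu, forall y,
  {ae mu, forall z, gray x y -> gray x z -> black y z}}}.
Proof.
pose C (p : (T * T) * (T * T)) := claw p.1.1 p.1.2 p.2.1 p.2.2.
have mC : measurable (C @^-1` [set 0]).
  rewrite -[X in measurable X]setTI.
  have m11 : measurable_fun setT (fun p : (T * T) * (T * T) => p.1.1).
    exact: measurableT_comp measurable_fst measurable_fst.
  have m12 : measurable_fun setT (fun p : (T * T) * (T * T) => p.1.2).
    exact: measurableT_comp measurable_snd measurable_fst.
  have m21 : measurable_fun setT (fun p : (T * T) * (T * T) => p.2.1).
    exact: measurableT_comp measurable_fst measurable_snd.
  have m22 : measurable_fun setT (fun p : (T * T) * (T * T) => p.2.2).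
    exact: measurableT_comp measurable_snd measurable_snd.
  have mB (f : (T * T) * (T * T) -> R) : measurable_fun setT f ->
      measurable_fun setT (fun p => 1 - f p).
    by move=> mf; exact: measurable_realfun.measurable_funB.
  pose k := measurable_kernel_comp.
  suff mC : measurable_fun setT C by exact: mC.
  exact: (measurable_funM (measurable_funM (measurable_funM (measurable_funM
    (measurable_funM (k _ _ _ _ m11 m12) (k _ _ _ _ m11 m21))
    (k _ _ _ _ m11 m22)) (mB _ (k _ _ _ _ m12 m21)))
    (mB _ (k _ _ _ _ m12 m22))) (mB _ (k _ _ _ _ m21 m22))).
(* The four variables are grouped as (centre, leaf) and (leaf, leaf), so that a single exchange
   brings the last two leaves, the future [y] and [z], to the front. *)
have cpair : {ae mu2, forall p, {ae mu2, forall q, C (p, q) = 0}}.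
  apply/(ae_prodP mu mu (measurable_ae_section mu2 mC)).
  apply: filterS claw0 => x; apply: filterS => a h.
  exact: (ae_prodP mu mu (measurable_slice1 mC (x, a))).2 h.
have {}cpair := (ae_swap mu2 mu2 mC).1 cpair.
have mC' : measurable ((fun r => C (r.2, r.1)) @^-1` [set 0]).
  rewrite -[X in measurable X]setTI.
  have msw : measurable_fun setT (fun r : (T * T) * (T * T) => (r.2, r.1)).
    exact: measurable_fun_pair.
  exact: msw mC.
pose E := [set r : (T * T) * T |
  gray r.2 r.1.1 -> gray r.2 r.1.2 -> black r.1.1 r.1.2].
have mE : measurable E.
  have m11 : measurable_fun setT (fun p : (T * T) * T => p.1.1).
    exact: measurableT_comp measurable_fst measurable_fst.
  have m12 : measurable_fun setT (fun p : (T * T) * T => p.1.2).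
    exact: measurableT_comp measurable_snd measurable_fst.
  rewrite (_ : E = ~` [set r | gray r.2 r.1.1] `|` (~` [set r | gray r.2 r.1.2]
      `|` [set r | black r.1.1 r.1.2])).
    apply: measurableU; first by apply/measurableC/measurable_gray.
    apply: measurableU; first by apply/measurableC/measurable_gray.
    exact: measurable_black.
  apply/seteqP; split=> -[[y z] x]; rewrite /E /=.
    by case: (gray x y) (gray x z) => -[]; intuition.
  by case=> [//|[//|//]].
(* The pair [(y, z)] is kept in front for [common_gray_null]; [x] moves to the front only in the
   conclusion. *)
suff : {ae mu2, forall q, {ae mu, forall x, E (q, x)}}.
  move/(ae_swap mu2 mu mE); apply: filterS => x h.
  exact: (ae_prodP mu mu (measurable_slice2 mE x)).1 h.
apply/(ae_prodP mu mu (measurable_ae_section mu mE)).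
move/(ae_prodP mu mu (measurable_ae_section mu2 mC')) : cpair.
apply: filterS2 claw0 => y cy; apply: filterS => z h.
case byz : (black y z); first by apply: filterE => x.
have : {ae mu, forall x, {ae mu, forall a, claw x a y z = 0}}.
  exact: (ae_prodP mu mu (measurable_slice2 mC (y, z))).1 h.
move/common_gray_null => /(_ cy); rewrite byz => /(_ isT).
by apply: filterS => x nE xy xz; case: nE.
Qed.

(** * Gray and black degrees *)

Variable I : set T.
Hypothesis mI : measurable I.
Hypothesis muI : mu I = 1%E.
Hypothesis wI : forall x y, w (x, y) != 0 -> I x.

Definition gdeg (x : T) : R := fine (mu [set y | gray x y]).
Definition bdeg (x : T) : R := fine (mu [set y | black x y]).

Lemma gray_supp x y : gray x y -> I x /\ I y.
Proof.
move=> /andP[w0 _]; split; first by apply: (wI (y := y)); rewrite gt_eqF.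
by apply: (wI (y := x)); rewrite wC gt_eqF.
Qed.

Lemma black_supp x y : black x y -> I x /\ I y.
Proof.
move=> /eqP w1; split; first by apply: (wI (y := y)); rewrite w1 oner_eq0.
by apply: (wI (y := x)); rewrite wC w1 oner_eq0.
Qed.

Lemma measurable_gray_nbh x : measurable [set y | gray x y].
Proof. exact: measurable_gray. Qed.

Lemma measurable_black_nbh x : measurable [set y | black x y].
Proof. exact: measurable_black. Qed.

Lemma subset_fineK A : measurable A -> A `<=` I -> mu A = (fine (mu A))%:E.
Proof.
move=> mA AI; rewrite fineK// ge0_fin_numE//.
apply: (@le_lt_trans _ _ 1%E); last exact: ltry.
by rewrite -muI; apply: le_measure; rewrite ?inE.
Qed.

Lemma gdegE x : mu [set y | gray x y] = (gdeg x)%:E.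
Proof.
apply: subset_fineK; first exact: measurable_gray_nbh.
by move=> y /= /gray_supp[].
Qed.

Lemma bdegE x : mu [set y | black x y] = (bdeg x)%:E.
Proof.
apply: subset_fineK; first exact: measurable_black_nbh.
by move=> y /= /black_supp[].
Qed.

Lemma gdeg_ge0 x : 0 <= gdeg x. Proof. exact: fine_ge0. Qed.
Lemma bdeg_ge0 x : 0 <= bdeg x. Proof. exact: fine_ge0. Qed.

Definition gray2 : set (T * T) := [set p | gray p.1 p.2].
Definition black2 : set (T * T) := [set p | black p.1 p.2].

Lemma mem_gray2 x y : ((x, y) \in gray2) = gray x y.
Proof. by apply/idP/idP; rewrite inE. Qed.

Lemma measurable_gray2 : measurable gray2. Proof. exact: measurable_gray. Qed.
Lemma measurable_black2 : measurable black2. Proof. exact: measurable_black. Qed.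

Lemma measurable_gdeg : measurable_fun setT gdeg.
Proof.
have /= h := measurable_fun_xsection mu measurable_gray2.
rewrite (_ : gdeg = fine \o (fun x => mu (xsection gray2 x))).
  apply: (measurable_comp measurableT) => //; exact: fine_measurable.
apply/funext => x /=; congr (fine (mu _)).
by apply/seteqP; split=> y; rewrite /xsection/= inE.
Qed.

Lemma measurable_bdeg : measurable_fun setT bdeg.
Proof.
have /= h := measurable_fun_xsection mu measurable_black2.
rewrite (_ : bdeg = fine \o (fun x => mu (xsection black2 x))).
  apply: (measurable_comp measurableT) => //; exact: fine_measurable.
apply/funext => x /=; congr (fine (mu _)).
by apply/seteqP; split=> y; rewrite /xsection/= inE.
Qed.

(** For a typical gray pair, almost every gray neighbour of [x] is a black neighbour of [y], whence
    [gdeg x <= bdeg y]; the other comparison follows by symmetry and exchange of quantifiers.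
    Positivity holds because a point of gray degree 0 is in a gray pair with almost no [y]. *)
Lemma gray_degrees : {ae mu, forall x, {ae mu, forall y,
  gray x y -> [/\ 0 < gdeg x, 0 < gdeg y, gdeg x <= bdeg y & gdeg y <= bdeg x]}}.
Proof.
pose E := [set p : T * T | gray p.1 p.2 -> 0 < gdeg p.1 /\ gdeg p.1 <= bdeg p.2].
have mE : measurable E.
  rewrite (_ : E = ~` gray2 `|` ((setT `&` [set p | (gdeg (fst p))%:E != 0%E])
    `&` (setT `&` [set p | gdeg p.1 <= bdeg p.2]))).
    apply: measurableU; first by apply: measurableC; exact: measurable_gray2.
    apply: measurableI.
      apply: emeasurable_neq => //; apply/measurable_EFinP.
      exact: measurableT_comp measurable_gdeg measurable_fst.
    apply: measurable_fun_le => //.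
      exact: measurableT_comp measurable_gdeg measurable_fst.
    exact: measurableT_comp measurable_bdeg measurable_snd.
  apply/seteqP; split=> -[x y]; rewrite /E /gray2 /=.
    case: (gray x y) => [/(_ isT)[x0 xy]|_]; last by left.
    by right; rewrite eqe gt_eqF.
  case=> [//|[[_ x0] [_ xy]] _]; split=> //.
  by rewrite lt_neqAle eq_sym gdeg_ge0 andbT; rewrite eqe in x0.
have aE : {ae mu, forall x, {ae mu, forall y, E (x, y)}}.
  apply: filterS gray_neighbours_black => x h.
  have : {ae mu, forall y, gray x y -> 0 < gdeg x}.
    have [g0|] := ltP 0 (gdeg x); first by apply: filterE.
    move=> g0; have /eqP : gdeg x = 0 by apply: le_anti; rewrite g0 gdeg_ge0.
    rewrite -eqe -gdegE => /eqP/(negligibleP mu (measurable_gray_nbh x)).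
    by apply: negligibleS => y /=; case: (gray x y) => // /(_ _)/[!implyFb] [].
  apply: filterS2 h => y h xgt0 xy; split; first exact: xgt0.
  rewrite -lee_fin -gdegE -bdegE; apply: ae_subset_measure.
  - exact: measurable_gray_nbh.
  - exact: measurable_black_nbh.
  - by apply: filterS h => z /(_ xy).
have aE' := (ae_swap mu mu mE).1 aE.
apply: filterS2 aE aE' => x; apply: filterS2 => y /= h1 h2 xy.
have [x0 xy1] := h1 xy; have [|y0 yx1] := h2; first by rewrite grayC.
by [].
Qed.

Local Open Scope ereal_scope.

Lemma gray2_gdeg : (mu \x mu) gray2 = \int[mu]_x (gdeg x)%:E.
Proof.
apply: eq_integral => x _ /=; rewrite -gdegE; congr (mu _).
by apply/seteqP; split=> y; rewrite /xsection/= inE.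
Qed.

Lemma black2_bdeg : (mu \x mu) black2 = \int[mu]_x (bdeg x)%:E.
Proof.
apply: eq_integral => x _ /=; rewrite -bdegE; congr (mu _).
by apply/seteqP; split=> y; rewrite /xsection/= inE.
Qed.

Lemma measurable_gray2M (k : T * T -> R) : measurable_fun setT k ->
  measurable_fun setT (fun p => (\1_gray2 p * k p)%R).
Proof.
move=> mk; apply: measurable_funM => //.
exact: (measurable_indic measurable_gray2).
Qed.

Section gray_weight.
Variable h : T -> R.
Hypothesis mh : measurable_fun setT h.
Hypothesis h0 : forall x, (0 <= h x)%R.

Let mhfst : measurable_fun setT (fun p : T * T => (\1_gray2 p * h p.1)%:E).
Proof.
apply/measurable_EFinP; apply: measurable_funM.
  exact: (measurable_indic measurable_gray2).
exact: measurableT_comp mh measurable_fst.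
Qed.

Let mhsnd : measurable_fun setT (fun p : T * T => (\1_gray2 p * h p.2)%:E).
Proof.
apply/measurable_EFinP; apply: measurable_funM.
  exact: (measurable_indic measurable_gray2).
exact: measurableT_comp mh measurable_snd.
Qed.

Let h1_ge0 (p : T * T) x : 0 <= (\1_gray2 p * h x)%:E.
Proof. by rewrite lee_fin mulr_ge0. Qed.

Lemma integral_gray_row x :
  \int[mu]_y (\1_gray2 (x, y) * h x)%:E = (gdeg x * h x)%:E.
Proof.
under eq_integral do rewrite mulrC EFinM.
rewrite ge0_integralZl_EFin//; last first.
  apply/measurable_EFinP.
  rewrite (_ : (fun y => _) = \1_[set y | gray x y]).
    exact: measurable_indic (measurable_gray_nbh x).
  by apply/funext => y; rewrite !indicE.
under eq_integral => y _ do rewrite (_ : \1_gray2 (x, y) = \1_[set y | gray x y] y)//.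
rewrite integral_indic//; last exact: measurable_gray_nbh.
by rewrite setIT mulrC EFinM; congr (_ * _); exact: gdegE.
Qed.

(** The two summands are integrated in opposite orders; the symmetry of the gray relation identifies
    the results. *)
Lemma integral_gray_weight : \int[mu \x mu]_p (\1_gray2 p * (h p.1 + h p.2))%:E
  = \int[mu]_x (gdeg x * h x)%:E + \int[mu]_x (gdeg x * h x)%:E.
Proof.
under eq_integral do rewrite mulrDr EFinD.
rewrite ge0_integralD//; congr (_ + _).
  rewrite fubini_tonelli1//.
  by apply: eq_integral => x _; exact: integral_gray_row.
rewrite fubini_tonelli2//; apply: eq_integral => y _.
rewrite -integral_gray_row; apply: eq_integral => x _ /=.
by rewrite !indicE !mem_gray2 grayC.
Qed.

End gray_weight.

(** With [h] the ratio of black to gray degree, almost every gray pair has [h x + h y >= gdeg y /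
    gdeg x + gdeg x / gdeg y >= 2]. So twice the gray measure is at most twice the integral of
    [gdeg x * h x], and this integrand is at most [bdeg x]. *)
Lemma gray_le_black : (mu \x mu) gray2 <= (mu \x mu) black2.
Proof.
(* Division by zero yields 0, so [h] vanishes where the gray degree does, and
   [gdeg x * h x <= bdeg x] holds everywhere. *)
pose h x := (bdeg x / gdeg x)%R.
have h0 x : (0 <= h x)%R by rewrite divr_ge0 ?gdeg_ge0 ?bdeg_ge0.
have mh : measurable_fun setT h.
  apply: measurable_funM; first exact: measurable_bdeg.
  (* Measurability of the inverse is obtained from that of the real power with exponent -1, which
     agrees with it on nonnegative reals. *)
  rewrite (_ : (fun x => _) = (fun x => powR x (-1)) \o gdeg).
    apply: (measurableT_comp _ measurable_gdeg); exact: measurable_powR.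
  by apply/funext => x /=; rewrite powR_inv1// gdeg_ge0.
have mk : measurable_fun setT (fun p : T * T => h p.1 + h p.2)%R.
  apply: measurable_funD.
    exact: measurableT_comp mh measurable_fst.
  exact: measurableT_comp mh measurable_snd.
have le2 : \int[mu \x mu]_p (\1_gray2 p * 2)%:E <=
    \int[mu \x mu]_p (\1_gray2 p * (h p.1 + h p.2))%:E.
  apply: ae_ge0_le_integral.
  - exact: measurableT.
  - by move=> p _; rewrite lee_fin mulr_ge0.
  - by apply/measurable_EFinP; exact: (measurable_gray2M (measurable_cst _)).
  - by move=> p _; rewrite lee_fin mulr_ge0// addr_ge0.
  - by apply/measurable_EFinP; exact: (measurable_gray2M mk).
  pose E := [set p : T * T | (\1_gray2 p * 2 <= \1_gray2 p * (h p.1 + h p.2))%R].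
  have mE : measurable E.
    rewrite -[E]setTI; apply: measurable_fun_le => //.
      exact: (measurable_gray2M (measurable_cst _)).
    exact: (measurable_gray2M mk).
  suff : {ae mu2, forall p, E p} by apply: filterS => p Ep _; rewrite lee_fin.
  apply/ae_prodP => //; apply: filterS gray_degrees => x; apply: filterS => y.
  rewrite /E/= indicE; case: (boolP ((x, y) \in gray2)); last by rewrite !mul0r.
  rewrite inE !mul1r => xy /(_ xy)[x0 y0 xy1 yx1].
  rewrite /h; set a := gdeg x in x0 xy1 yx1 *; set b := gdeg y in y0 xy1 yx1 *.
  apply: (@le_trans _ _ (b / a + a / b)%R); last first.
    by rewrite lerD// ler_pM2r// invr_gt0.
  rewrite -subr_ge0 (_ : _ - _ = (a - b) ^+ 2 / (a * b))%R.
    by rewrite divr_ge0 ?sqr_ge0// mulr_ge0// ltW.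
  by field; rewrite !gt_eqF.
rewrite integral_gray_weight// in le2.
have le1 : \int[mu]_x (gdeg x * h x)%:E <= (mu \x mu) black2.
  rewrite black2_bdeg; apply: ge0_le_integral.
  - exact: measurableT.
  - by move=> x _; rewrite lee_fin mulr_ge0// gdeg_ge0.
  - by apply/measurable_EFinP/measurable_funM => //; exact: measurable_gdeg.
  - by apply/measurable_EFinP; exact: measurable_bdeg.
  move=> x _; rewrite lee_fin /h.
  have [->|g0] := eqVneq (gdeg x) 0%R; first by rewrite mul0r bdeg_ge0.
  by rewrite mulrC -mulrA mulVf// mulr1.
have := le_trans le2 (leeD le1 le1).
under eq_integral do rewrite mulrC EFinM.
rewrite ge0_integralZl_EFin//; last first.
  by apply/measurable_EFinP; exact: (measurable_indic measurable_gray2).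
rewrite integral_indic ?setIT//; last exact: measurable_gray2.
rewrite [X in _ <= X -> _](_ : _ = 2%:E * (mu \x mu) black2); last first.
  by rewrite mule_natl mule2n.
by rewrite lee_pmul2l// ltr0n.
Qed.

(** * The extremal case: gray and black pairs of measure one half each *)

Section half_gray.
Hypothesis gray_half : (mu \x mu) gray2 = (2^-1)%:E.
Hypothesis black_half : (mu \x mu) black2 = (2^-1)%:E.

(** The gray and the black pairs are disjoint subsets of the square over [I] and their measures add
    up to its measure 1. *)
Lemma ae_gray_or_black : {ae mu, forall x, {ae mu, forall y,
  I x -> I y -> gray x y || black x y}}.
Proof.
pose P := gray2 `|` black2.
have mP : measurable P.
  by apply: measurableU; [exact: measurable_gray2|exact: measurable_black2].
have mII : measurable (I `*` I) by exact: measurableX.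
have PI : P `<=` I `*` I.
  by move=> [x y] [/gray_supp[]|/black_supp[]].
have P1 : mu2 P = 1.
  rewrite /P measureU//.
  - rewrite [X in X + _]gray_half [X in _ + X]black_half.
    by rewrite -EFinD; congr EFin; lra.
  - exact: measurable_gray2.
  - exact: measurable_black2.
  apply/seteqP; split=> // -[x y] [/= /andP[_ w1] /eqP w1'].
  by rewrite w1' ltxx in w1.
have II1 : mu2 (I `*` I) = 1.
  by rewrite [LHS]product_measure1E// muI mule1.
have mD : measurable (I `*` I `\` P) by exact: measurableD.
have d0 : mu2 (I `*` I `\` P) = 0.
  have := II1; rewrite -[in X in X -> _](setDUK PI) measureU//; last first.
    by rewrite setDE setICA setICr setI0.
  have aux (r : \bar R) : 1 + r = 1 -> r = 0.
    by case: r => [r [e]||] //; congr EFin; lra.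
  by rewrite [X in X + _]P1 => /aux.
have := (negligibleP mu2 mD).2 d0 => aD.
have : {ae (mu \x mu), forall p, (~` (I `*` I `\` P)) p}.
  by apply: negligibleS aD => p /contrapT.
move/(ae_prodP mu mu (measurableC mD)); apply: filterS => x; apply: filterS => y.
move=> nP Ix Iy; apply: contrapT => /negP; rewrite negb_or.
by move=> /andP[/negP g /negP b]; apply: nP; split=> // -[].
Qed.

Lemma gdeg_bdeg : {ae mu, forall x, I x -> (gdeg x + bdeg x)%R = 1%R}.
Proof.
apply: filterS ae_gray_or_black => x h Ix; apply: EFin_inj.
rewrite EFinD -gdegE -bdegE -measureU; last 3 first.
- exact: measurable_gray_nbh.
- exact: measurable_black_nbh.
- apply/seteqP; split=> // y [/= /andP[_ w1] /eqP w1'].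
  by rewrite w1' ltxx in w1.
have mU : measurable ([set y | gray x y] `|` [set y | black x y]).
  apply: measurableU; first exact: measurable_gray_nbh.
  exact: measurable_black_nbh.
rewrite -muI; apply: le_anti; apply/andP; split.
  by apply: le_measure; rewrite ?inE// => y [/gray_supp[]|/black_supp[]].
apply: ae_subset_measure => //; apply: filterS h => y h Iy.
by have /orP := h Ix Iy.
Qed.

(** The degree argument for Mantel's theorem. As the two degrees add up to 1, [gdeg x <= bdeg y]
    becomes [gdeg x + gdeg y <= 1] on gray pairs. Integrating over them bounds the integral of the
    square of [gdeg] by 1/4, while [gdeg] has integral 1/2; so its variance on [I] is 0. *)
Lemma gdeg_regular : {ae mu, forall x, I x -> gdeg x = 2^-1%R}.
Proof.
have sum1 : {ae mu, forall x, {ae mu, forall y,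
    gray x y -> (gdeg x + gdeg y <= 1)%R}}.
  apply: filterS gray_degrees => x; apply: filterS2 gdeg_bdeg => y h1 h2 xy.
  have [_ _ xy1 _] := h2 xy; have [_ Iy] := gray_supp xy.
  by rewrite -(h1 Iy) addrC lerD2l.
have mg := measurable_gdeg; have g0 := gdeg_ge0.
have mind : measurable_fun setT (\1_gray2 : _ -> R).
  exact: (measurable_indic measurable_gray2).
have mk : measurable_fun setT (fun p : T * T => gdeg p.1 + gdeg p.2)%R.
  apply: measurable_funD.
    exact: measurableT_comp mg measurable_fst.
  exact: measurableT_comp mg measurable_snd.
have le1 : \int[mu \x mu]_p (\1_gray2 p * (gdeg p.1 + gdeg p.2))%:E <= (2^-1)%:E.
  have <- : \int[mu \x mu]_p (\1_gray2 p)%:E = (2^-1)%:E.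
    by rewrite integral_indic ?setIT//; exact: measurable_gray2.
  apply: ae_ge0_le_integral.
  - exact: measurableT.
  - by move=> p _; rewrite lee_fin mulr_ge0// addr_ge0.
  - by apply/measurable_EFinP; exact: (measurable_gray2M mk).
  - by move=> p _; rewrite lee_fin.
  - exact/measurable_EFinP.
  pose E := [set p : T * T | (\1_gray2 p * (gdeg p.1 + gdeg p.2) <= \1_gray2 p)%R].
  have mE : measurable E.
    rewrite -[E]setTI; apply: measurable_fun_le => //.
    exact: (measurable_gray2M mk).
  suff : {ae mu \x mu, forall p, E p} by apply: filterS => p Ep _; rewrite lee_fin.
  apply/ae_prodP => //; apply: filterS sum1 => x; apply: filterS => y.
  rewrite /E/= indicE mem_gray2; case: (gray x y); last by rewrite !mul0r.
  by move=> /(_ isT); rewrite mul1r.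
rewrite integral_gray_weight// in le1.
pose f x := ((gdeg x - 2^-1) ^+ 2 * \1_I x)%R.
have mi : measurable_fun setT (\1_I : _ -> R) by exact: measurable_indic.
have mf : measurable_fun setT f.
  apply: measurable_funM => //; apply: measurable_funX.
  exact: measurable_realfun.measurable_funB.
have f0 x : (0 <= f x)%R by rewrite /f mulr_ge0// sqr_ge0.
(* The expansion of the square is arranged so that both sides are sums of nonnegative functions,
   which allows integration term by term. Outside [I] both sides vanish because the gray degree
   does. *)
have sumE : \int[mu]_x (f x)%:E + \int[mu]_x (gdeg x)%:E =
    \int[mu]_x (gdeg x * gdeg x)%:E + (4^-1)%:E.
  have <- : \int[mu]_x (4^-1 * \1_I x)%:E = (4^-1)%:E.
    under eq_integral do rewrite EFinM.
    rewrite ge0_integralZl_EFin//; last exact/measurable_EFinP.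
    by rewrite integral_indic// setIT [X in _ * X]muI mule1.
  have E1 : measurable_fun setT (fun x => (f x)%:E) by exact/measurable_EFinP.
  have E2 : measurable_fun setT (fun x => (gdeg x)%:E) by exact/measurable_EFinP.
  have E3 : measurable_fun setT (fun x => (gdeg x * gdeg x)%:E).
    by apply/measurable_EFinP; exact: (measurable_funM mg mg).
  have E4 : measurable_fun setT (fun x : T => ((4^-1 : R) * \1_I x)%:E).
    by apply/measurable_EFinP; exact: (measurable_funM (measurable_cst _) mi).
  rewrite -!ge0_integralD//; try by move=> x _; rewrite lee_fin ?f0// mulr_ge0.
  apply: eq_integral => x _; rewrite -!EFinD; congr EFin.
  rewrite /f indicE; case: (boolP (x \in I)) => [_|].
    by rewrite !mulr1; field.
  rewrite notin_setE => nI; suff -> : gdeg x = 0%R by rewrite /= !mulr0.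
  apply: EFin_inj; rewrite -gdegE (_ : [set y | _] = set0) ?measure0//.
  by apply/seteqP; split=> // y /= /gray_supp[].
have f_int0 : \int[mu]_x (f x)%:E = 0.
  have gi : \int[mu]_x (gdeg x)%:E = (2^-1)%:E.
    by rewrite -gray_half; exact/esym/gray2_gdeg.
  have : 0 <= \int[mu]_x (f x)%:E by apply: integral_ge0 => x _; rewrite lee_fin.
  move: sumE le1 gi.
  case: (\int[mu]_x (f x)%:E) => [u||]; case: (\int[mu]_x (gdeg x * gdeg x)%:E) => [v||];
    case: (\int[mu]_x (gdeg x)%:E) => [t||] //=.
  case=> uv; rewrite -EFinD !lee_fin => v2 [t2] u0; congr EFin; lra.
have : ae_eq mu setT (fun x => (f x)%:E) (cst 0).
  apply/ae_eq_integral_abs => //; first exact/measurable_EFinP.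
  by rewrite -[RHS]f_int0; apply: eq_integral => x _; rewrite gee0_abs// lee_fin.
apply: filterS => x /(_ Logic.I) [] /eqP; rewrite /f indicE.
rewrite mulf_eq0 sqrf_eq0 subr_eq0 => /orP[/eqP//|].
by case: (boolP (x \in I)) => [_|/negP nI _ Ix]; [rewrite oner_eq0|case: nI; rewrite inE].
Qed.

(** [S] is the gray neighbourhood of a typical point, hence a black clique of measure 1/2. The gray
    neighbourhood of a typical point of [S] avoids [S] up to a null set and also has measure 1/2, so
    it is essentially the complement [U]. Being a gray neighbourhood, [U] is a black clique too. *)
Lemma two_cliques (q : R) :
  {ae mu, forall x, {ae mu, forall y, gray x y -> w (x, y) = q}} ->
  exists S, [/\ measurable S, S `<=` I, mu S = (2^-1)%:E &
    {ae mu, forall x, {ae mu, forall y, I x -> I y ->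
      w (x, y) = (if (x \in S) == (y \in S) then 1 else q)%R}}].
Proof.
move=> wq.
have I0 : mu I != 0 by rewrite muI eqe oner_eq0.
have [x0 Ix0 [c1 [c2 /(_ Ix0) gx0]]] := ae_ex mI (filterI ae_gray_or_black
  (filterI gray_neighbours_black gdeg_regular)) I0.
pose S := [set y | gray x0 y].
have mS : measurable S by exact: measurable_gray_nbh.
have SI : S `<=` I by move=> y /gray_supp[].
have muS : mu S = (2^-1)%:E by rewrite gdegE gx0.
pose U := I `\` S.
have mU : measurable U by exact: measurableD.
have muU : mu U = (2^-1)%:E.
  have : mu I = mu S + mu U.
    rewrite -{1}(setDUK SI) measureU//.
    by rewrite setDE setICA setICr setI0.
  rewrite muI muS; case: (mu U) => [r [e]||] //.
  by congr EFin; lra.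
have c3 : {ae mu, forall y, S y -> {ae mu, forall z, S z -> black y z}}.
  apply: filterS c2 => y h Sy; apply: filterS h => z h Sz; exact: h.
have c4 : {ae mu, forall y, S y -> {ae mu, forall z, U z -> gray y z}}.
  apply: filterS3 c3 ae_gray_or_black gdeg_regular => y h1 h2 h3 Sy.
  have Iy := SI _ Sy; apply: ae_subset_sym => //.
  - exact: measurable_gray_nbh.
  - by rewrite [RHS]muU [LHS]gdegE h3.
  - by rewrite [X in X \is a _]gdegE.
  apply: filterS (h1 Sy) => z Sz yz.
  have [_ Iz] := gray_supp yz; split=> // /Sz /eqP w1.
  by case/andP: yz; rewrite w1 ltxx.
have c5 : {ae mu, forall z, U z -> {ae mu, forall z', U z' -> black z z'}}.
  have S0 : mu S != 0 by rewrite muS eqe invr_eq0 pnatr_eq0.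
  have [y Sy [/(_ Sy) h1 h2]] := ae_ex mS (filterI c4 gray_neighbours_black) S0.
  apply: filterS2 (h1) h2 => z yz h Uz; apply: filterS2 h h1 => z' h yz' Uz'.
  by apply: h; [exact: yz|exact: yz'].
pose E := [set p : T * T | S p.1 -> U p.2 -> gray p.1 p.2].
have mE : measurable E.
  rewrite (_ : E = ~` (S `*` U) `|` gray2).
    apply: measurableU; last exact: measurable_gray2.
    by apply: measurableC; exact: measurableX.
  apply/seteqP; split=> -[x y]; rewrite /E /gray2/=.
    by move=> h; have [SU|] := pselect (S x /\ U y); [right; apply: h; case: SU|left].
  by case=> [SU Sx Uy|//]; case: SU.
(* Exchanging the quantifiers of [c4] handles the pairs whose first point lies in [U] and whose
   second lies in [S]. *)
have c6 : {ae mu, forall z, {ae mu, forall y, S y -> U z -> gray y z}}.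
  apply: (ae_swap mu mu mE).1; apply: filterS c4 => y h.
  have [Sy|nSy] := pselect (S y); last by apply: filterE => z.
  by apply: filterS (h Sy) => z Uz _.
exists S; split=> //.
apply: filterS3 c3 c4 (filterI c5 (filterI c6 wq)) => x a3 a4 [a5 [a6 aq]].
have [Sx|nSx] := pselect (S x).
  apply: filterS3 (a3 Sx) (a4 Sx) aq => y b3 b4 bq Ix Iy; rewrite (mem_set Sx).
  have [Sy|nSy] := pselect (S y); first by rewrite (mem_set Sy); exact/eqP/b3.
  by rewrite (memNset nSy); apply/bq/b4.
have [Ix|nIx] := pselect (I x); last by apply: filterE => y.
have Ux : U x by split.
apply: filterS3 (a5 Ux) a6 aq => y b5 b6 bq _ Iy; rewrite (memNset nSx).
have [Sy|nSy] := pselect (S y).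
  by rewrite (mem_set Sy); apply: bq; rewrite grayC; exact: b6.
by rewrite (memNset nSy); apply/eqP/b5.
Qed.

End half_gray.

End claw_free_kernel.

(** * The iterated Lebesgue measure on tuples *)

Section tuple_lebesgue_theory.
Variable R : realType.
Local Notation mR := (measurableTypeR R).
Local Notation mu := (@lebesgue_measure R).
Local Notation tl := (@tuple_lebesgue R).
Local Open Scope ereal_scope.

Lemma integral_tuple_cons n (f : n.+1.-tuple mR -> \bar R) :
  measurable_fun setT f -> (forall t, 0 <= f t) ->
  \int[tl n.+1]_t f t = \int[mu]_x \int[tl n]_t f (cons_pair (x, t)).
Proof.
move=> mf f0; rewrite /= /lebesgue_cons ge0_integral_pushforward//; last first.
  exact: measurable_cons_pair.
rewrite preimage_setT fubini_tonelli1// => [|p]; last exact: f0.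
exact: measurableT_comp mf (@measurable_cons_pair R n).
Qed.

Lemma measurable_cons_slice n (E : set (n.+1.-tuple mR)) x : measurable E ->
  measurable [set t | E (cons_pair (x, t))].
Proof.
move=> mE; have : measurable ((@cons_pair R n) @^-1` E).
  by rewrite -[X in measurable X]setTI; exact: measurable_cons_pair.
by move/(measurable_slice1)/(_ x).
Qed.

(** Peels off one coordinate; iterated, it turns a statement about almost every 4-tuple into four
    nested quantifiers. *)
Lemma ae_tuple_cons n (E : set (n.+1.-tuple mR)) : measurable E ->
  {ae tl n.+1, forall t, E t} <->
  {ae mu, forall x, {ae tl n, forall t, E (cons_pair (x, t))}}.
Proof.
move=> mE; have mE' : measurable ((@cons_pair R n) @^-1` E).
  by rewrite -[X in measurable X]setTI; exact: measurable_cons_pair.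
rewrite -(ae_prodP mu (tl n) mE') (ae_setP (tl n.+1) mE).
exact: iff_sym (ae_setP (prod_measure mu (tl n)) mE').
Qed.

Lemma tnth_cons_pair0 n (p : R * n.-tuple mR) : tnth (cons_pair p) ord0 = p.1.
Proof. by []. Qed.

Lemma tnth_cons_pairS n (p : R * n.-tuple mR) (i : 'I_n) :
  tnth (cons_pair p) (lift ord0 i) = tnth p.2 i.
Proof. by rewrite (tnth_nth 0%R) [RHS](tnth_nth 0%R). Qed.

Lemma unit_cube_cons n (p : R * n.-tuple mR) :
  unit_cube (cons_pair p) <-> unit_interval p.1 /\ unit_cube p.2.
Proof.
split=> [h|[h0 h] i].
  by split=> [|i]; [exact: (h ord0)|rewrite -tnth_cons_pairS; exact: h].
by have [j ->|->] := unliftP ord0 i; rewrite ?tnth_cons_pairS ?tnth_cons_pair0.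
Qed.

Lemma measurable_unit_interval : measurable (@unit_interval R).
Proof. exact: measurable_itv. Qed.

Lemma measurable_unit_cube n : measurable (@unit_cube R n).
Proof.
rewrite (_ : @unit_cube R n = \bigcap_(i in [set: 'I_n])
    ((fun t : n.-tuple mR => tnth t i) @^-1` @unit_interval R)).
  apply: fin_bigcap_measurable => [|i _]; first exact: finite_finset.
  rewrite -[X in measurable X]setTI.
  by apply: measurable_tnth => //; exact: measurable_unit_interval.
by apply/seteqP; split=> t h i; [move=> _; exact: h|exact: (h i)].
Qed.

Lemma lebesgue_unit_interval : mu (@unit_interval R) = 1.
Proof. by rewrite lebesgue_measure_itv/= lte_fin ltr01 sube0. Qed.

Lemma integral_unit_cube_cons n (f : n.+1.-tuple mR -> \bar R) :
  measurable_fun setT f -> (forall t, 0 <= f t) ->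
  \int[tl n.+1]_(t in @unit_cube R n.+1) f t =
  \int[mu]_(x in @unit_interval R) \int[tl n]_(t in @unit_cube R n) f (cons_pair (x, t)).
Proof.
move=> mf f0; rewrite integral_mkcond integral_tuple_cons; last 2 first.
- by apply/(measurable_restrictT f (measurable_unit_cube (n := n.+1))); exact: measurable_funTS.
- by move=> t; rewrite /patch; case: ifP.
rewrite [RHS]integral_mkcond; apply: eq_integral => x _.
rewrite [RHS]/patch; case: ifPn => [/set_mem Ix|/negP nIx].
  rewrite [RHS]integral_mkcond; apply: eq_integral => t _.
  rewrite /patch; congr (if _ then _ else _).
  by apply/idP/idP => /set_mem h; apply/mem_set; move: h;
    rewrite unit_cube_cons/=; tauto.
rewrite integral0_eq// => t _; rewrite /patch memNset// unit_cube_cons/= => -[Ix].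
by case: nIx; exact/mem_set.
Qed.

Lemma ae_tnth n (E : set mR) (i : 'I_n) : measurable E ->
  {ae mu, forall x, E x} -> {ae tl n, forall t, E (tnth t i)}.
Proof.
move=> mE aE; have mi n' (j : 'I_n') : measurable [set t : n'.-tuple mR | E (tnth t j)].
  by rewrite -[X in measurable X]setTI; exact: measurable_tnth.
elim: n i => [[]//|n IH] i; apply/(ae_tuple_cons (mi _ i)).
have [j ->|->] := unliftP ord0 i.
  apply: ae_all => x; apply: ae_imp (IH j) => t.
  by rewrite /= tnth_cons_pairS.
by apply: ae_imp aE => x Ex; exact: ae_all.
Qed.

(** By induction on the dimension. Coordinates are peeled off from the left, so the one of smaller
    index plays the role of the outer variable of [aE]; hence the condition [i < j]. *)
Lemma ae_tnth_pair n (E : set (mR * mR)) (i j : 'I_n) : measurable E ->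
  {ae mu, forall x, {ae mu, forall y, E (x, y)}} -> (i < j)%N ->
  {ae tl n, forall t, E (tnth t i, tnth t j)}.
Proof.
move=> mE aE.
have mi n' (k l : 'I_n') :
    measurable [set t : n'.-tuple mR | E (tnth t k, tnth t l)].
  rewrite -[X in measurable X]setTI.
  by apply: (measurable_fun_pair (measurable_tnth k) (measurable_tnth l)).
elim: n i j => [[]//|n IH] i j ij; apply/(ae_tuple_cons (mi _ i j)).
have [j' jE|jE] := unliftP ord0 j; last by rewrite jE in ij.
have [i' iE|iE] := unliftP ord0 i.
  have ij' : (i' < j')%N by move: ij; rewrite iE jE !lift0.
  apply: ae_all => x; apply: ae_imp (IH _ _ ij') => t.
  by rewrite /= iE jE !tnth_cons_pairS.
apply: ae_imp aE => x h.
apply: ae_imp (ae_tnth j' (measurable_slice1 mE x) h) => t.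
by rewrite /= iE jE tnth_cons_pairS tnth_cons_pair0.
Qed.

End tuple_lebesgue_theory.

(** * Binary entropy *)

Section binary_entropy_bounds.
Variable R : realType.
Implicit Types q w : R.

Lemma ln2_gt0 : 0 < ln (2 : R).
Proof. by apply: ln_gt0; rewrite ltr1n. Qed.

Lemma ln_le_sub1 (x : R) : 0 < x -> ln x <= x - 1.
Proof.
by move=> x0; rewrite -{1}(subrK 1 x) addrC; apply: le_ln1Dx; lra.
Qed.

(** Strictness comes from the weak inequality at the square root [s] of [x]:
    [ln x = 2 ln s <= 2 (s - 1) < s^2 - 1], as [(s - 1)^2 > 0]. *)
Lemma ln_lt_sub1 (x : R) : 0 < x -> x != 1 -> ln x < x - 1.
Proof.
move=> x0 x1; set s := Num.sqrt x.
have s0 : 0 < s by rewrite sqrtr_gt0.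
have sx : s ^+ 2 = x by rewrite sqr_sqrtr// ltW.
have s1 : s != 1 by apply: contra x1 => /eqP s1; rewrite -sx s1 expr1n.
have := ln_le_sub1 s0.
have : 0 < (s - 1) ^+ 2 by rewrite exprn_even_gt0//= subr_eq0.
rewrite -sx lnXn//; nra.
Qed.

(** Gibbs' inequality: apply [ln t <= t - 1] at [q / w], where it is strict, and at
    [(1 - q) / (1 - w)]. The right side is the tangent line of the entropy at [q]. *)
Lemma binary_entropy_lt q w : 0 < q < 1 -> 0 < w < 1 -> w != q ->
  binary_entropy w < w * - log2 q + (1 - w) * - log2 (1 - q).
Proof.
move=> /andP[q0 q1] /andP[w0 w1] wq; have l2 := ln2_gt0.
have q1' : 0 < 1 - q by lra.
have w1' : 0 < 1 - w by lra.
have h1 : ln (q / w) < q / w - 1.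
  apply: ln_lt_sub1; first by rewrite divr_gt0.
  apply: contra wq => /eqP h; apply/eqP.
  by rewrite -[LHS]mul1r -h divfK// gt_eqF.
have h2 : ln ((1 - q) / (1 - w)) <= (1 - q) / (1 - w) - 1.
  by apply: ln_le_sub1; rewrite divr_gt0.
rewrite !ln_div ?posrE// in h1 h2.
have {}h1 : w * (ln q - ln w) < q - w.
  rewrite -(@ltr_pM2l _ w)// in h1; apply: (lt_le_trans h1).
  by rewrite mulrBr mulrCA divff ?gt_eqF// !mulr1.
have {}h2 : (1 - w) * (ln (1 - q) - ln (1 - w)) <= w - q.
  rewrite -(@ler_pM2l _ (1 - w))// in h2; apply: (le_trans h2).
  by rewrite mulrBr mulrCA divff ?gt_eqF// !mulr1; lra.
rewrite /binary_entropy /log2 -subr_gt0.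
have -> : w * - (ln q / ln 2) + (1 - w) * - (ln (1 - q) / ln 2) -
    (- w * (ln w / ln 2) - (1 - w) * (ln (1 - w) / ln 2)) =
    - (w * (ln q - ln w) + (1 - w) * (ln (1 - q) - ln (1 - w))) / ln 2.
  by field; rewrite gt_eqF.
by rewrite divr_gt0//; lra.
Qed.

Lemma binary_entropyE q :
  binary_entropy q = q * - log2 q + (1 - q) * - log2 (1 - q).
Proof. by rewrite /binary_entropy mulNr !mulrN. Qed.

Lemma binary_entropy_le q w : 0 < q < 1 -> 0 < w < 1 ->
  binary_entropy w <= w * - log2 q + (1 - w) * - log2 (1 - q).
Proof.
move=> q01 w01; have [->|wq] := eqVneq w q; first by rewrite binary_entropyE.
by rewrite ltW// binary_entropy_lt.
Qed.

Lemma log2_lt0 q : 0 < q < 1 -> log2 q < 0.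
Proof. by move=> q01; rewrite /log2 pmulr_llt0 ?ln_lt0// invr_gt0 ln2_gt0. Qed.

Lemma binary_entropy0 : binary_entropy 0 = 0 :> R.
Proof. by rewrite /binary_entropy /log2 !subr0 ln1 mul0r mulr0 subr0 oppr0 mul0r. Qed.

Lemma binary_entropy1 : binary_entropy 1 = 0 :> R.
Proof. by rewrite /binary_entropy subrr mul0r subr0 /log2 ln1 mul0r mulr0. Qed.

Lemma binary_entropy_gt0 w : 0 < w < 1 -> 0 < binary_entropy w.
Proof.
move=> /andP[w0 w1]; rewrite binary_entropyE addr_gt0// mulr_gt0 ?subr_gt0//.
  by rewrite oppr_gt0 log2_lt0// w0.
by rewrite oppr_gt0 log2_lt0//; lra.
Qed.

Lemma binary_entropy_ge0 w : 0 <= w <= 1 -> 0 <= binary_entropy w.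
Proof.
move=> /andP[]; rewrite le_eqVlt => /orP[/eqP<- _|w0].
  by rewrite binary_entropy0.
rewrite le_eqVlt => /orP[/eqP->|w1]; first by rewrite binary_entropy1.
by rewrite ltW// binary_entropy_gt0// w0.
Qed.

Lemma measurable_binary_entropy : measurable_fun setT (@binary_entropy R).
Proof.
have ml : measurable_fun setT (@log2 R).
  by apply: measurable_funM => //; exact: measurable_ln.
have m1 : measurable_fun setT (fun x : R => 1 - x).
  exact: measurable_realfun.measurable_funB.
apply: measurable_realfun.measurable_funB.
  by apply: measurable_funM => //; exact: measurable_funN.
by apply: measurable_funM => //; exact: (measurableT_comp ml m1).
Qed.

Local Notation q0 := ((3 - Num.sqrt 5) / 2 : R).

Lemma sqrt5_sqr : Num.sqrt 5 ^+ 2 = 5 :> R.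
Proof. by rewrite sqr_sqrtr. Qed.

Lemma sqrt5_bounds : 2 < Num.sqrt (5 : R) < 3.
Proof.
have := sqrt5_sqr; have : 0 <= Num.sqrt 5 :> R by exact: sqrtr_ge0.
by set s := Num.sqrt 5 => s0 s2; apply/andP; split; nra.
Qed.

Lemma gamma0E : gamma0 R = (1 + q0) / 2.
Proof. by rewrite /gamma0; lra. Qed.

(** The gray value of the optimal graphons. In the upper range it is the value giving density
    [gamma] when half of the pairs are black and half gray; below [gamma0] it stays at the root [q0]
    of [q = (1 - q)^2]. *)
Definition opt_density (gamma : R) : R :=
  if gamma < gamma0 R then q0 else 2 * gamma - 1.

Lemma opt_density_itv gamma : 0 < gamma < 1 -> 0 < opt_density gamma < 1.
Proof.
have /andP[s2 s3] := sqrt5_bounds.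
rewrite /opt_density gamma0E => /andP[g0 g1]; have [g|g] := ltP gamma; apply/andP; split; lra.
Qed.

Lemma log2_sqr (x : R) : 0 < x -> log2 (x ^+ 2) = 2 * log2 x.
Proof. by move=> x0; rewrite /log2 lnXn// mulr2n mulrDl mulr_natl mulr2n. Qed.

Lemma ler_log2 (x y : R) : 0 < x -> 0 < y -> x <= y -> log2 x <= log2 y.
Proof.
by move=> x0 y0 xy; rewrite /log2 ler_pM2r ?invr_gt0 ?ln2_gt0// ler_ln.
Qed.

Lemma log2_q0 : log2 q0 = 2 * log2 (1 - q0).
Proof.
have /andP[s2 s3] := sqrt5_bounds; have := sqrt5_sqr.
move=> s5; rewrite -log2_sqr; last by lra.
by congr log2; nra.
Qed.

(** Since [q0 = (1 - q0)^2], the entropy of [q0] is [(1 + q0)] times [- log2 (1 - q0)], and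
    [(5 + sqrt 5) / 10] is the inverse of [1 + q0]. *)
Lemma rstar_low gamma : gamma < gamma0 R ->
  rstar gamma = gamma * - log2 (1 - q0).
Proof.
move=> g; rewrite /rstar g binary_entropyE log2_q0.
have := sqrt5_sqr; set s := Num.sqrt 5; set L := log2 _ => s5.
have -> : (5 + s) / 10 * ((3 - s) / 2 * - (2 * L) + (1 - (3 - s) / 2) * - L) * gamma
   = (25 - s ^+ 2) / 20 * (gamma * - L) by field.
by rewrite s5; field.
Qed.

(* [m], [o] and [gamma - o] are the measure of the gray pairs, the measure of
   the black pairs and the integral of the graphon over the gray pairs. *)
Lemma rstar_bound gamma m o : 0 < gamma < 1 -> m <= o -> m + o <= 1 ->
  (gamma - o) * - log2 (opt_density gamma) +
  (m - (gamma - o)) * - log2 (1 - opt_density gamma) <= rstar gamma.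
Proof.
move=> g01 mo mo1; set q := opt_density gamma; have q01 := opt_density_itv g01.
have /andP[g0 g1] := g01; have /andP[] := q01; rewrite -/q => q_gt0 q_lt1.
have b0 : log2 (1 - q) < 0 by apply: log2_lt0; lra.
have [g|g] := ltP gamma (gamma0 R).
  have qE : q = q0 by rewrite /q /opt_density g.
  (* With [log2 q = 2 b] the left side collapses to [(gamma + m - o)] times [- b], so [m <= o]
     suffices. *)
  rewrite rstar_low// qE log2_q0 -qE; move: b0; set b := log2 (1 - q); nra.
have qE : q = 2 * gamma - 1 by rewrite /q /opt_density ltNge g.
have -> : rstar gamma = 2^-1 * binary_entropy q by rewrite /rstar ltNge g/= qE.
rewrite binary_entropyE.
(* From [q0 <= q]: [(1 - q)^2 <= (1 - q0)^2 = q0 <= q]. *)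
have ab : 2 * log2 (1 - q) <= log2 q.
  rewrite -log2_sqr; last by lra.
  apply: ler_log2 => //; first by rewrite exprn_gt0//; lra.
  have := sqrt5_sqr; have /andP[s2 s3] := sqrt5_bounds.
  move: g; rewrite gamma0E => g s5.
  have : q0 <= q by lra.
  nra.
have a0 : log2 q < 0 by apply: log2_lt0.
have eE : gamma = (q + 1) / 2 by lra.
rewrite eE -subr_ge0; set a := log2 q in ab a0 *; set b := log2 (1 - q) in ab b0 *.
suff : 0 <= (o - 2^-1) * - a + (1 - m - o) * - b.
  by congr (0 <= _); field.
(* For [o >= 1/2] both terms are nonnegative. Otherwise [m <= o] gives [1 - m - o >= 1 - 2 o], and
   [- a <= - 2 b] makes the second term outweigh the first. *)
have [h|h] := leP (2^-1) o; nra.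
Qed.

End binary_entropy_bounds.

(** * From graphons to kernels *)

(** The nonnegative difference has integral 0, by cancelling the finite value [r]. *)
Lemma ae_eq_of_integral d (X : measurableType d) (R : realType)
    (nu : {measure set X -> \bar R}) (f g : X -> R) (r : R) :
  measurable_fun setT f -> measurable_fun setT g ->
  (forall x, 0 <= f x <= g x) ->
  (\int[nu]_x (f x)%:E = r%:E)%E -> (\int[nu]_x (g x)%:E = r%:E)%E ->
  {ae nu, forall x, f x = g x}.
Proof.
move=> mf mg fg fr gr; pose h x := g x - f x.
have mh : measurable_fun setT h by exact: measurable_realfun.measurable_funB.
have f0 x : 0 <= f x by case/andP: (fg x).
have h0 x : 0 <= h x by rewrite subr_ge0; case/andP: (fg x).
have h_int : (\int[nu]_x (h x)%:E = 0)%E.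
  have : (\int[nu]_x (f x + h x)%:E = r%:E)%E.
    by rewrite -gr; apply: eq_integral => x _; rewrite /h addrC subrK.
  under eq_integral do rewrite EFinD.
  rewrite ge0_integralD//; last 4 first.
  - by move=> x _; rewrite lee_fin.
  - exact/measurable_EFinP.
  - by move=> x _; rewrite lee_fin.
  - exact/measurable_EFinP.
  by rewrite fr; case: (\int[nu]_x _)%E => [s [e]||] //; congr EFin; lra.
have : ae_eq nu setT (fun x => (h x)%:E) (cst 0%E).
  apply/ae_eq_integral_abs => //; first exact/measurable_EFinP.
  by rewrite -[RHS]h_int; apply: eq_integral => x _; rewrite gee0_abs// lee_fin.
by apply: filterS => x /(_ Logic.I) [] /eqP; rewrite /h subr_eq0 => /eqP.
Qed.

(** * The entropy as an integral over the gray pairs *)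

Section entropy_integral.
Context d (X : measurableType d) (R : realType).
Variable nu : {measure set X -> \bar R}.
Variable w : X -> R.
Hypothesis mw : measurable_fun setT w.
Hypothesis w01 : forall p, 0 <= w p <= 1.

Let G := [set p | 0 < w p < 1].
Let B := [set p | w p = 1].
Variables (m o gamma : R).
Hypothesis nuG : nu G = m%:E.
Hypothesis nuB : nu B = o%:E.
Hypothesis w_int : (\int[nu]_p (w p)%:E = gamma%:E)%E.

Let mG : measurable G.
Proof.
rewrite -[G]setTI (_ : G = w @^-1` `]0, 1[%classic); first exact: mw.
by apply/seteqP; split=> p; rewrite /G/= in_itv.
Qed.

Let mB : measurable B.
Proof. by rewrite -[B]setTI; apply: (mw measurableT (measurable_set1 1)). Qed.

Let miG : measurable_fun setT (\1_G : X -> R). Proof. exact: measurable_indic. Qed.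
Let miB : measurable_fun setT (\1_B : X -> R). Proof. exact: measurable_indic. Qed.

Let w0 p : 0 <= w p. Proof. by case/andP: (w01 p). Qed.
Let w1 p : 0 <= 1 - w p. Proof. by rewrite subr_ge0; case/andP: (w01 p). Qed.

Let mGw : measurable_fun setT (fun p => \1_G p * w p).
Proof. exact: measurable_funM. Qed.

Let mGw1 : measurable_fun setT (fun p => \1_G p * (1 - w p)).
Proof.
apply: measurable_funM => //.
exact: measurable_realfun.measurable_funB.
Qed.

(** For [a = - log2 q] and [b = - log2 (1 - q)] this is Gibbs' upper bound for the entropy, cut off
    where the entropy vanishes anyway; for [a = 1] and [b = 0] it is [w] restricted to the gray
    points. *)
Definition gray_affine (a b : R) (p : X) : R :=
  \1_G p * (w p * a + (1 - w p) * b).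

Lemma measurable_gray_affine a b : measurable_fun setT (gray_affine a b).
Proof.
apply: measurable_funM => //; apply: measurable_funD; first exact: measurable_funM.
by apply: measurable_funM => //; exact: measurable_realfun.measurable_funB.
Qed.

Local Open Scope ereal_scope.

(** As [w] is 1 on [B] and 0 off [G] and [B], its integral over [G] is [gamma - o], and that of
    [1 - w] is what remains of [m]. *)
Lemma integral_gray_affine (a b : R) : (0 <= a)%R -> (0 <= b)%R ->
  \int[nu]_p (gray_affine a b p)%:E =
  ((gamma - o) * a + (m - (gamma - o)) * b)%:E.
Proof.
move=> a0 b0.
have e1 : \int[nu]_p (\1_G p * w p)%:E = (gamma - o)%:E.
  have : \int[nu]_p (\1_B p + \1_G p * w p)%:E = gamma%:E.
    rewrite -w_int; apply: eq_integral => p _; congr EFin.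
    have /andP[+ +] := w01 p; rewrite le_eqVlt => /orP[/eqP wp _|wp0].
      rewrite !indicE !memNset ?mul0r ?addr0// /G /B/= -wp ?ltxx//.
      by move/eqP; rewrite eq_sym oner_eq0.
    rewrite le_eqVlt => /orP[/eqP wp|wp1].
      rewrite !indicE (@mem_set _ B)//.
      by rewrite (@memNset _ G) ?mul0r ?addr0 ?wp// /G/= wp ltxx andbF.
    rewrite !indicE (@mem_set _ G) ?mul1r; last by rewrite /G/= wp0.
    by rewrite (@memNset _ B) ?add0r// /B/= => wp; rewrite wp ltxx in wp1.
  under eq_integral do rewrite EFinD.
  rewrite ge0_integralD//; last 3 first.
  - exact/measurable_EFinP.
  - by move=> x _; rewrite lee_fin mulr_ge0.
  - exact/measurable_EFinP.
  rewrite integral_indic// setIT [X in X + _]nuB.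
  by case: (\int[nu]_x _) => [s [e]||] //; congr EFin; lra.
have e2 : \int[nu]_p (\1_G p * (1 - w p))%:E = (m - (gamma - o))%:E.
  have : \int[nu]_p (\1_G p * w p + \1_G p * (1 - w p))%:E = m%:E.
    rewrite -nuG -[G in RHS](setIT G) -integral_indic//.
    by apply: eq_integral => p _; congr EFin; ring.
  under eq_integral do rewrite EFinD.
  rewrite ge0_integralD//; last 4 first.
  - by move=> x _; rewrite lee_fin mulr_ge0.
  - exact/measurable_EFinP.
  - by move=> x _; rewrite lee_fin mulr_ge0.
  - exact/measurable_EFinP.
  rewrite e1; by case: (\int[nu]_x _) => [s [e]||] //; congr EFin; lra.
transitivity (\int[nu]_p (a%:E * (\1_G p * w p)%:E + b%:E * (\1_G p * (1 - w p))%:E)).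
  by apply: eq_integral => p _; rewrite -!EFinM -EFinD; congr EFin; rewrite /gray_affine; ring.
rewrite ge0_integralD//; last 4 first.
- by move=> p _; rewrite -EFinM lee_fin mulr_ge0// mulr_ge0.
- by apply/measurable_EFinP; exact: measurable_funM.
- by move=> p _; rewrite -EFinM lee_fin mulr_ge0// mulr_ge0.
- by apply/measurable_EFinP; exact: measurable_funM.
rewrite !ge0_integralZl_EFin//; last 4 first.
- by move=> x _; rewrite lee_fin mulr_ge0.
- exact/measurable_EFinP.
- by move=> x _; rewrite lee_fin mulr_ge0.
- exact/measurable_EFinP.
by rewrite e1 e2 -!EFinM -EFinD; congr EFin; ring.
Qed.

Variable q : R.
Hypothesis q01 : (0 < q < 1)%R.
Let a := (- log2 q)%R.
Let b := (- log2 (1 - q))%R.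
Let a0 : (0 <= a)%R. Proof. by rewrite oppr_ge0 ltW// log2_lt0. Qed.
Let b0 : (0 <= b)%R.
Proof.
by case/andP: q01 => q0 q1; rewrite oppr_ge0 ltW// log2_lt0//; apply/andP; split; lra.
Qed.

Let mH : measurable_fun setT (fun p => binary_entropy (w p)).
Proof. exact: measurableT_comp (@measurable_binary_entropy R) mw. Qed.

Let H_le p : (0 <= binary_entropy (w p) <= gray_affine a b p)%R.
Proof.
rewrite binary_entropy_ge0//=.
have [wp|wp] := boolP (0 < w p < 1)%R.
  rewrite /gray_affine indicE (@mem_set _ G)// mul1r; exact: binary_entropy_le.
rewrite /gray_affine indicE (@memNset _ G) ?mul0r//=; last exact/negP.
have /andP[+ +] := w01 p; rewrite le_eqVlt => /orP[/eqP<- _|wp0].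
  by rewrite binary_entropy0.
by rewrite le_eqVlt => /orP[/eqP->|wp1]; [rewrite binary_entropy1|rewrite wp0 wp1 in wp].
Qed.

Lemma integral_entropy_le : \int[nu]_p (binary_entropy (w p))%:E <=
  ((gamma - o) * - log2 q + (m - (gamma - o)) * - log2 (1 - q))%:E.
Proof.
rewrite -integral_gray_affine//; apply: ge0_le_integral => //.
- by move=> p _; rewrite lee_fin; case/andP: (H_le p).
- exact/measurable_EFinP.
- by apply/measurable_EFinP; exact: measurable_gray_affine.
- by move=> p _; rewrite lee_fin; case/andP: (H_le p).
Qed.

(** The entropy and its affine bound have the same finite integral, so they agree almost everywhere,
    whereas Gibbs' inequality is strict at gray values other than [q]. *)
Lemma integral_entropy_eq : \int[nu]_p (binary_entropy (w p))%:E =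
    ((gamma - o) * - log2 q + (m - (gamma - o)) * - log2 (1 - q))%:E ->
  {ae nu, forall p, (0 < w p < 1)%R -> w p = q}.
Proof.
move=> eH; have := ae_eq_of_integral mH (measurable_gray_affine a b) H_le eH
  (integral_gray_affine a0 b0).
apply: ae_imp => p Hp wp; apply/eqP/negPn/negP => wq.
have := binary_entropy_lt q01 wp wq.
by rewrite Hp /gray_affine indicE (@mem_set _ G)// mul1r ltxx.
Qed.

End entropy_integral.

(** * Extending a graphon by zero *)

Section graphon_kernel.
Variable R : realType.
Local Notation mR := (measurableTypeR R).
Local Notation mu := (@lebesgue_measure R).
Local Notation I := (@unit_interval R).
Local Notation II := (@unit_square R).
Variable W : graphon R.

(** Discards the arbitrary values of a graphon off the unit square, so that all integrals can be
    taken over the whole space. *)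
Definition kernel : mR * mR -> R := (W : mR * mR -> R) \_ II.

Lemma measurable_unit_square : measurable II.
Proof. by apply: measurableX; exact: measurable_unit_interval. Qed.

Lemma kernelE p : II p -> kernel p = W p.
Proof. by move=> Ip; rewrite /kernel patchE mem_set. Qed.

Lemma kernel_out p : ~ II p -> kernel p = 0.
Proof. by move=> Ip; rewrite /kernel patchE memNset. Qed.

Lemma measurable_kernel : measurable_fun setT kernel.
Proof.
apply/(measurable_restrictT _ measurable_unit_square).
exact: measurable_graphon.
Qed.

Lemma kernel01 p : 0 <= kernel p <= 1.
Proof.
have [Ip|nIp] := pselect (II p); first by rewrite kernelE// graphon_itv.
by rewrite kernel_out// lexx ler01.
Qed.

Lemma kernelC x y : kernel (x, y) = kernel (y, x).
Proof.
have [Ip|nIp] := pselect (II (x, y)).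
  have Iyx : II (y, x) by case: Ip.
  by rewrite !kernelE// graphon_sym.
have nIyx : ~ II (y, x) by move=> [? ?]; apply: nIp; split.
by rewrite !kernel_out.
Qed.

Lemma kernel_supp x y : kernel (x, y) != 0 -> I x.
Proof.
have [[]//|nIp] := pselect (II (x, y)).
by rewrite kernel_out// eqxx.
Qed.

Local Open Scope ereal_scope.

Lemma edge_density_kernel : edge_density W = \int[mu \x mu]_p (kernel p)%:E.
Proof.
rewrite /edge_density integral_mkcond; apply: eq_integral => p _.
by rewrite /kernel !patchE; case: ifP.
Qed.

Lemma entropy_kernel :
  entropy W = \int[mu \x mu]_p (binary_entropy (kernel p))%:E.
Proof.
rewrite /entropy integral_mkcond; apply: eq_integral => p _.
by rewrite /kernel !patchE; case: ifP => // _; rewrite [in RHS]binary_entropy0.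
Qed.

Lemma claw_density_kernel : claw_density W = \int[@tuple_lebesgue R 4]_x
  (claw kernel (tnth x ord0) (tnth x (lift ord0 ord0))
     (tnth x (lift ord0 (lift ord0 ord0)))
     (tnth x (lift ord0 (lift ord0 (lift ord0 ord0)))))%:E.
Proof.
rewrite /claw_density integral_mkcond; apply: eq_integral => x _.
rewrite patchE; case: ifPn => [/set_mem Ix|/negP nIx].
  congr EFin.
  have prod4 (P : pred 'I_4) (f : 'I_4 -> R) : (\prod_(i < 4 | P i) f i =
      (if P ord0 then f ord0 else 1) *
      ((if P (lift ord0 ord0) then f (lift ord0 ord0) else 1) *
      ((if P (lift ord0 (lift ord0 ord0)) then f (lift ord0 (lift ord0 ord0)) else 1) *
      (if P (lift ord0 (lift ord0 (lift ord0 ord0)))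
       then f (lift ord0 (lift ord0 (lift ord0 ord0))) else 1))))%R.
    by rewrite big_mkcond !big_ord_recl big_ord0/= mulr1.
  rewrite !prod4/= !mul1r !mulr1.
  rewrite /claw !kernelE; last 6 first.
  - by split; exact: Ix.
  - by split; exact: Ix.
  - by split; exact: Ix.
  - by split; exact: Ix.
  - by split; exact: Ix.
  - by split; exact: Ix.
  by rewrite ?mulr1 !mulrA.
apply/esym; congr EFin; apply: contrapT => /eqP; rewrite /claw !mulf_eq0 !negb_or => h.
apply: nIx; apply/mem_set => i; move: h => /andP[/andP[/andP[/andP[/andP[h1 h2] h3] _] _] _].
have [j ->|->] := unliftP ord0 i; last exact: kernel_supp h1.
rewrite kernelC in h1; rewrite kernelC in h2; rewrite kernelC in h3.
have [k ->|->] := unliftP ord0 j; last exact: kernel_supp h1.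
have [l ->|->] := unliftP ord0 k; last exact: kernel_supp h2.
by rewrite (ord1 l); exact: kernel_supp h3.
Qed.

End graphon_kernel.

(** * The entropy bound for claw-free graphons and its equality case *)

Section claw_free_graphon.
Variable R : realType.
Local Notation mR := (measurableTypeR R).
Local Notation mu := (@lebesgue_measure R).
Local Notation I := (@unit_interval R).
Local Notation II := (@unit_square R).
Variable W : graphon R.
Local Notation w := (kernel W).
Local Open Scope ereal_scope.

Lemma claw_kernel_ge0 x a b c : (0 <= claw w x a b c)%R.
Proof.
have w0 p : (0 <= w p)%R by case/andP: (kernel01 W p).
have w1 p : (0 <= 1 - w p)%R by rewrite subr_ge0; case/andP: (kernel01 W p).
by rewrite /claw !mulr_ge0.
Qed.

Lemma measurable_claw_tuple : measurable_fun setT (fun x : 4.-tuple mR =>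
  claw w (tnth x ord0) (tnth x (lift ord0 ord0))
     (tnth x (lift ord0 (lift ord0 ord0)))
     (tnth x (lift ord0 (lift ord0 (lift ord0 ord0))))).
Proof.
have k (i j : 'I_4) :
    measurable_fun setT (fun x : 4.-tuple mR => w (tnth x i, tnth x j)).
  exact: (measurable_kernel_comp (measurable_kernel W) (measurable_tnth i)
    (measurable_tnth j)).
have kB (i j : 'I_4) :
    measurable_fun setT (fun x : 4.-tuple mR => 1 - w (tnth x i, tnth x j))%R.
  by apply: measurable_realfun.measurable_funB => //; exact: k.
exact: (measurable_funM (measurable_funM (measurable_funM (measurable_funM
  (measurable_funM (k _ _) (k _ _)) (k _ _)) (kB _ _)) (kB _ _)) (kB _ _)).
Qed.

Hypothesis W_claw : claw_density W = 0.

Lemma claw_kernel_ae : {ae mu, forall x, {ae mu, forall a, {ae mu, forall b,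
  {ae mu, forall c, claw w x a b c = 0%R}}}}.
Proof.
have mc := measurable_claw_tuple.
set c4 := (fun x : 4.-tuple mR => _) in mc.
have mE : measurable [set x | c4 x = 0%R].
  by rewrite -[X in measurable X]setTI; exact: (mc measurableT [set 0%R] (measurable_set1 0%R)).
have : {ae tuple_lebesgue R 4, forall x, c4 x = 0%R}.
  have : ae_eq (tuple_lebesgue R 4) setT (fun x => (c4 x)%:E) (cst 0).
    apply/ae_eq_integral_abs => //; first exact/measurable_EFinP.
    rewrite -[RHS]W_claw claw_density_kernel; apply: eq_integral => x _.
    by rewrite gee0_abs// lee_fin claw_kernel_ge0.
  by apply: ae_imp => x /(_ Logic.I) [].
move/(ae_tuple_cons mE); apply: ae_imp => x.
move/(ae_tuple_cons (measurable_cons_slice x mE)); apply: ae_imp => a.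
move/(ae_tuple_cons (measurable_cons_slice a (measurable_cons_slice x mE))).
apply: ae_imp => b.
move/(ae_tuple_cons (measurable_cons_slice b (measurable_cons_slice a
  (measurable_cons_slice x mE)))).
apply: ae_imp => c h.
(* After four coordinates a quantifier over the empty tuple is left; its measure is a Dirac mass, so
   the statement holds at some point. *)
have d1 : tuple_lebesgue R 0 setT != 0.
  by rewrite /= diracE in_setT eqe oner_eq0.
have [t _] := ae_ex measurableT h d1.
by rewrite /= /c4 !tnth_cons_pairS !tnth_cons_pair0.
Qed.

Let mw := measurable_kernel W.
Let w01 := kernel01 W.
Let wC := kernelC W.
Let wI := @kernel_supp R W.
Let mI := @measurable_unit_interval R.
Let muI := @lebesgue_unit_interval R.

Lemma gray_black_measure : exists m o : R,
  [/\ (mu \x mu) (gray2 w) = m%:E, (mu \x mu) (black2 w) = o%:E,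
      (m <= o)%R & (m + o <= 1)%R].
Proof.
have mg := measurable_gray2 mw; have mb := measurable_black2 mw.
have mgb : measurable (gray2 w `|` black2 w) by exact: measurableU.
have gb0 : gray2 w `&` black2 w = set0.
  apply/seteqP; split=> // -[x y] [/= /andP[_ w1] /eqP w1'].
  by rewrite w1' ltxx in w1.
have sub : gray2 w `|` black2 w `<=` II.
  move=> [x y]; rewrite /gray2 /black2 /= /unit_square/=.
  by move=> [/(gray_supp wC wI)|/(black_supp wC wI)].
have le1 : (mu \x mu) (gray2 w) + (mu \x mu) (black2 w) <= 1.
  rewrite -measureU//.
  apply: (@le_trans _ _ ((mu \x mu) II)).
    by apply: le_measure; rewrite ?inE//; exact: measurable_unit_square.
  by rewrite [leLHS]product_measure1E// [X in X * _]muI [X in _ * X]muI mule1.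
have le := gray_le_black mw w01 wC claw_kernel_ae mI muI wI.
have g0 : 0 <= (mu \x mu) (gray2 w) by exact: measure_ge0.
have b0 : 0 <= (mu \x mu) (black2 w) by exact: measure_ge0.
move: le1 le g0 b0.
case: ((mu \x mu) (gray2 w)) => [m||] //; case: ((mu \x mu) (black2 w)) => [k||] //.
by rewrite -EFinD !lee_fin => mo1 mo _ _; exists m, k.
Qed.

Lemma gray2_set : gray2 w = [set p | (0 < w p < 1)%R].
Proof. by apply/seteqP; split=> -[x y]. Qed.

Lemma black2_set : black2 w = [set p | w p = 1%R].
Proof. by apply/seteqP; split=> -[x y] /eqP. Qed.

Variable gamma : R.
Hypothesis W_density : edge_density W = gamma%:E.

Let w_int : \int[mu \x mu]_p (w p)%:E = gamma%:E.
Proof. by rewrite -edge_density_kernel. Qed.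

Lemma entropy_le_rstar : (0 < gamma < 1)%R -> entropy W <= (rstar gamma)%:E.
Proof.
move=> g01; have [m [bl [mE oE mo mo1]]] := gray_black_measure.
rewrite gray2_set in mE; rewrite black2_set in oE.
rewrite entropy_kernel.
apply: (le_trans (integral_entropy_le mw w01 mE oE w_int (opt_density_itv g01))).
by rewrite lee_fin rstar_bound.
Qed.

(** Equality in Gibbs' inequality forces [w = q] on almost all gray pairs. The entropy is then [m]
    times that of [q], so that [m = 1/2]; the density gives the same value for the black pairs, and
    [two_cliques] applies. *)
Lemma optimal_two_cliques : (gamma0 R <= gamma < 1)%R ->
  entropy W = (rstar gamma)%:E ->
  exists S, [/\ measurable S, S `<=` I, mu S = (2^-1)%:E &
    {ae mu, forall x, {ae mu, forall y, I x -> I y ->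
      w (x, y) = (if (x \in S) == (y \in S) then 1 else 2 * gamma - 1)%R}}].
Proof.
move=> /andP[g0 g1] Wopt; have [s2 s3] := andP (sqrt5_bounds R).
have g01 : (0 < gamma < 1)%R.
  by rewrite g1 andbT; move: g0; rewrite gamma0E; lra.
have [m [bl [mE oE mo mo1]]] := gray_black_measure.
have mE' := mE; have oE' := oE.
rewrite gray2_set in mE'; rewrite black2_set in oE'.
pose q := (2 * gamma - 1)%R.
have qE : opt_density gamma = q by rewrite /opt_density ltNge g0.
have q01 := opt_density_itv g01; rewrite qE in q01.
have [q_gt0 q_lt1] := andP q01.
have rE : rstar gamma = (2^-1 * binary_entropy q)%R by rewrite /rstar ltNge g0.
have ent_le := integral_entropy_le mw w01 mE' oE' w_int q01.
have ent_eq : (rstar gamma = (gamma - bl) * - log2 q + (m - (gamma - bl)) * - log2 (1 - q))%R.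
  apply/eqP; rewrite eq_le; apply/andP; split.
    by rewrite -lee_fin -Wopt entropy_kernel.
  by rewrite -qE rstar_bound.
have wq : {ae mu \x mu, forall p, (0 < w p < 1)%R -> w p = q}.
  apply: (integral_entropy_eq mw w01 mE' oE' w_int q01).
  by rewrite -ent_eq -Wopt entropy_kernel.
(* Taking [a = 1] and [b = 0] in [gray_affine] computes the integral of [w] over the gray pairs,
   where [w] is the constant [q]. *)
have mean : (gamma - bl = m * q)%R.
  have := integral_gray_affine mw w01 mE' oE' w_int ler01 (lexx 0%R).
  rewrite mulr0 addr0 mulr1 => h; apply: EFin_inj; rewrite -h.
  have mi : measurable_fun setT (\1_[set p | (0 < w p < 1)%R] : mR * mR -> R).
    by apply: measurable_indic; rewrite -gray2_set; exact: measurable_gray2.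
  transitivity (\int[mu \x mu]_p (q * \1_[set p | (0 < w p < 1)%R] p)%:E).
    apply: ge0_ae_eq_integral => //.
    - by apply/measurable_EFinP; exact: measurable_gray_affine.
    - by apply/measurable_EFinP; exact: measurable_funM.
    - move=> p _; rewrite lee_fin mulr_ge0// mulr1 mulr0 addr0.
      by case/andP: (w01 p).
    - by move=> p _; rewrite lee_fin mulr_ge0// ltW.
    apply: ae_imp wq => p wp _; congr EFin; rewrite /gray_affine mulr1 mulr0 addr0.
    rewrite indicE; case: (boolP (p \in _)) => [/set_mem /wp ->|_]; last by rewrite mul0r mulr0.
    by rewrite mulrC.
  under eq_integral do rewrite EFinM.
  rewrite ge0_integralZl_EFin//; last by rewrite ltW.
    rewrite integral_indic//; last by rewrite -gray2_set; exact: measurable_gray2.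
    by rewrite setIT [X in _ * X]mE' -EFinM mulrC.
  exact/measurable_EFinP.
have m2 : m = (2^-1)%R.
  have := binary_entropy_gt0 q01; have := binary_entropyE q.
  move: ent_eq; rewrite rE mean; set H := binary_entropy q => e1 e2 H0.
  have Hn0 : H != 0%R by rewrite gt_eqF.
  apply: (mulIf Hn0).
  by rewrite e1 {1}e2; ring.
have o2 : bl = (2^-1)%R by move: mean; rewrite m2 /q; lra.
apply: (two_cliques mw w01 wC claw_kernel_ae mI muI wI).
- by rewrite mE m2.
- by rewrite oE o2.
pose E := [set p : mR * mR | (0 < w p < 1)%R -> w p = q].
have mE1 : measurable E.
  rewrite (_ : E = ~` gray2 w `|` (setT `&` w @^-1` [set q])).
    apply: measurableU; first by apply: measurableC; exact: measurable_gray2.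
    exact: mw.
  rewrite gray2_set setTI; apply/seteqP; split=> p /=; rewrite /E/=.
    by case: (boolP (0 < w p < 1)%R) => _ h; [right; exact: h|left].
  by case=> [h /h|].
by have := (ae_prodP mu mu mE1).1 wq; apply: ae_imp => x; apply: ae_imp => y.
Qed.

End claw_free_graphon.

(** * Graphons determined by a finite labelling *)

Section labelled.
Variable R : realType.
Local Notation mR := (measurableTypeR R).
Local Notation mu := (@lebesgue_measure R).
Local Notation tl := (@tuple_lebesgue R).
Local Notation I := (@unit_interval R).
Local Notation II := (@unit_square R).
Variable L : finType.

(** The sum of [F] over all label tuples weighted by products of [p], written as nested sums to
    follow the recursion defining [tuple_lebesgue]. *)
Fixpoint label_sum (p : L -> R) n : (n.-tuple L -> R) -> R :=
  match n with
  | 0 => fun F => F [tuple]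
  | k.+1 => fun F => \sum_l p l * label_sum p (fun t => F [tuple of l :: t])
  end.

Lemma eq_label_sum p p' n (F F' : n.-tuple L -> R) :
  p =1 p' -> F =1 F' -> label_sum p F = label_sum p' F'.
Proof.
move=> pp; elim: n F F' => [|n IH] F F' FF /=; first exact: FF.
by apply: eq_bigr => l _; rewrite pp; congr (_ * _); apply: IH => t.
Qed.

Lemma label_sum_ge0 p n (F : n.-tuple L -> R) : (forall l, 0 <= p l) ->
  (forall t, 0 <= F t) -> 0 <= label_sum p F.
Proof.
move=> p0; elim: n F => [|n IH] F F0 /=; first exact: F0.
by apply: sumr_ge0 => l _; rewrite mulr_ge0// IH.
Qed.

Variable c : mR -> L.
Hypothesis mc : forall l, measurable [set x | c x = l].

Definition label_mass (l : L) : R := fine (mu (I `&` [set x | c x = l])).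

Lemma label_mass_ge0 l : 0 <= label_mass l. Proof. exact: fine_ge0. Qed.

Let mA l : measurable (I `&` [set x | c x = l]).
Proof. by apply: measurableI => //; exact: measurable_unit_interval. Qed.

Lemma label_massE l : (mu (I `&` [set x | c x = l]) = (label_mass l)%:E)%E.
Proof.
exact: (subset_fineK (@measurable_unit_interval R)
  (@lebesgue_unit_interval R) (mA l) (@subIsetl _ _ _)).
Qed.

Local Open Scope ereal_scope.

Lemma integral_label (f : L -> R) : (forall l, (0 <= f l)%R) ->
  \int[mu]_(x in I) (f (c x))%:E = (\sum_l label_mass l * f l)%:E.
Proof.
move=> f0; have mi l : measurable_fun setT (\1_(I `&` [set x | c x = l]) : mR -> R).
  exact: measurable_indic.
transitivity (\int[mu]_x (\sum_l (f l * \1_(I `&` [set x | c x = l]) x)%:E)).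
  rewrite integral_mkcond; apply: eq_integral => x _; rewrite patchE.
  rewrite sumEFin; case: ifPn => [/set_mem Ix|/negP nIx]; congr EFin.
    rewrite (bigD1 (c x))//= indicE mem_set// mulr1 big1 ?addr0// => l lx.
    rewrite indicE memNset ?mulr0// => -[_ /= xl].
    by rewrite xl eqxx in lx.
  rewrite big1// => l _; rewrite indicE memNset ?mulr0// => -[Ix _].
  by apply: nIx; exact/mem_set.
rewrite ge0_integral_sum//; last 2 first.
- by move=> l; apply/measurable_EFinP; exact: measurable_funM.
- by move=> l x _; rewrite lee_fin mulr_ge0.
rewrite -sumEFin; apply: eq_bigr => l _; under eq_integral do rewrite EFinM.
rewrite ge0_integralZl_EFin//; last exact/measurable_EFinP.
by rewrite integral_indic// setIT [X in _ * X]label_massE -EFinM mulrC.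
Qed.

(** A function of finitely many labels is a finite combination of indicators of label classes. *)
Lemma measurable_labels n (F : n.-tuple L -> R) :
  measurable_fun setT (fun t : n.-tuple mR => F (map_tuple c t)).
Proof.
pose A (s : n.-tuple L) := [set t : n.-tuple mR | map_tuple c t = s].
have mAs s : measurable (A s).
  rewrite (_ : A s = \bigcap_(i in [set: 'I_n])
      ((fun t : n.-tuple mR => tnth t i) @^-1` [set x | c x = tnth s i])).
    apply: fin_bigcap_measurable => [|i _]; first exact: finite_finset.
    by rewrite -[X in measurable X]setTI; apply: measurable_tnth.
  apply/seteqP; split=> t /= h; first by move=> i _ /=; rewrite -h tnth_map.
  by apply: eq_from_tnth => i; rewrite tnth_map; exact: (h i).
rewrite (_ : (fun t => _) = (fun t => \sum_(s : n.-tuple L) F s * \1_(A s) t)%R).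
  apply: measurable_sum => s; apply: measurable_funM => //.
apply/funext => t; rewrite (bigD1 (map_tuple c t))//= indicE mem_set// mulr1.
rewrite big1 ?addr0// => s st; rewrite indicE memNset ?mulr0// => /= ts.
by rewrite ts eqxx in st.
Qed.

Lemma integral_labels n (F : n.-tuple L -> R) : (forall s, (0 <= F s)%R) ->
  \int[tl n]_(t in @unit_cube R n) (F (map_tuple c t))%:E =
  (label_sum label_mass F)%:E.
Proof.
elim: n F => [|n IH] F F0.
  rewrite /= integral_dirac; last 2 first.
  - exact: measurable_unit_cube.
  - by apply/measurable_EFinP; apply: measurable_funTS; exact: measurable_labels.
  rewrite diracE mem_set ?mul1e; last by case.
  by congr (F _)%:E; exact: val_inj.
rewrite integral_unit_cube_cons; last 2 first.
- by apply/measurable_EFinP; exact: measurable_labels.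
- by move=> t; rewrite lee_fin.
rewrite /= -integral_label; last first.
  by move=> l; apply: label_sum_ge0 => //; exact: label_mass_ge0.
apply: eq_integral => x _; rewrite -IH//; apply: eq_integral => t _.
by congr (F _)%:E; exact: val_inj.
Qed.

Lemma measurable_label2 (g : L -> L -> R) :
  measurable_fun setT (fun p : mR * mR => g (c p.1) (c p.2)).
Proof.
have mAlk l k : measurable [set p : mR * mR | c p.1 = l /\ c p.2 = k].
  apply: measurableI; rewrite -[X in measurable X]setTI.
    exact: (@measurable_fst _ _ mR mR measurableT [set x | c x = l] (mc l)).
  exact: (@measurable_snd _ _ mR mR measurableT [set x | c x = k] (mc k)).
rewrite (_ : (fun p => _) = (fun p : mR * mR => \sum_(lk : L * L) g lk.1 lk.2 *
    \1_[set p : mR * mR | c p.1 = lk.1 /\ c p.2 = lk.2] p)%R).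
  apply: measurable_sum => lk; apply: measurable_funM => //.
apply/funext => p; rewrite (bigD1 (c p.1, c p.2))//= indicE mem_set// mulr1.
rewrite big1 ?addr0// => -[l k] lk; rewrite indicE memNset ?mulr0// => /= -[h1 h2].
by rewrite h1 h2 eqxx in lk.
Qed.

Lemma integral_label2 (g : L -> L -> R) : (forall l k, (0 <= g l k)%R) ->
  \int[mu \x mu]_(p in II) (g (c p.1) (c p.2))%:E =
  (\sum_l label_mass l * \sum_k label_mass k * g l k)%:E.
Proof.
move=> g0.
have mg := measurable_label2 g.
rewrite integral_mkcond fubini_tonelli1; last 2 first.
- apply/(measurable_restrictT _ (@measurable_unit_square R)).
  by apply/measurable_EFinP; exact: measurable_funTS.
- by move=> p; rewrite patchE; case: ifP => // _; rewrite lee_fin.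
rewrite -integral_label; last first.
  by move=> l; apply: sumr_ge0 => k _; rewrite mulr_ge0// label_mass_ge0.
rewrite [RHS]integral_mkcond; apply: eq_integral => x _; rewrite /fubini_F.
rewrite [RHS]patchE; case: ifPn => [/set_mem Ix|/negP nIx].
  rewrite -integral_label// [RHS]integral_mkcond; apply: eq_integral => y _.
  rewrite !patchE; congr (if _ then _ else _).
  by apply/idP/idP => /set_mem h; apply/mem_set; [case: h|split].
rewrite integral0_eq// => y _; rewrite patchE memNset// => -[/= Ix _].
by apply: nIx; exact/mem_set.
Qed.

Variable M : L -> L -> R.
Hypothesis M0 : forall l k, (0 <= M l k)%R.

(** Densities thus depend only on [M] and the label masses, which serves both to prove equivalence
    and to refute it. Each edge is taken with increasing ranks, so [ae_tnth_pair] applies to each of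
    the finitely many factors. *)
Lemma hom_density_labels (F : sgraph) (W : graphon R) :
  {ae mu, forall x, {ae mu, forall y, I x -> I y ->
    kernel W (x, y) = M (c x) (c y)}} ->
  hom_density F W = (label_sum label_mass (fun s : #|F|.-tuple L =>
    \prod_(e : F * F | adj e.1 e.2 && (enum_rank e.1 < enum_rank e.2)%N)
       M (tnth s (enum_rank e.1)) (tnth s (enum_rank e.2))))%:E.
Proof.
move=> WM; rewrite -integral_labels; last by move=> s; exact: prodr_ge0.
set cond := fun e : F * F => adj e.1 e.2 && (enum_rank e.1 < enum_rank e.2)%N.
pose k (t : #|F|.-tuple mR) :=
  (\prod_(e : F * F | cond e)
    kernel W (tnth t (enum_rank e.1), tnth t (enum_rank e.2)))%R.
pose G (s : #|F|.-tuple L) := (\prod_(e : F * F | cond e)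
  M (tnth s (enum_rank e.1)) (tnth s (enum_rank e.2)))%R.
have k0 t : (0 <= k t)%R.
  by apply: prodr_ge0 => e _; case/andP: (kernel01 W
    (tnth t (enum_rank e.1), tnth t (enum_rank e.2))).
have mk : measurable_fun setT k.
  rewrite (_ : k = fun t => \prod_(e : F * F) (if cond e then
      kernel W (tnth t (enum_rank e.1), tnth t (enum_rank e.2)) else 1))%R; last first.
    by apply/funext => t; rewrite /k big_mkcond.
  apply: measurable_prod => e _; case: (cond e) => //.
  exact: (measurable_kernel_comp (measurable_kernel W)
    (measurable_tnth _) (measurable_tnth _)).
transitivity (\int[tl #|F|]_(t in @unit_cube R #|F|) (k t)%:E).
  apply: eq_integral => t /set_mem It; congr EFin; apply: eq_bigr => e _.
  by rewrite kernelE//; split; exact: It.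
apply: ge0_ae_eq_integral.
- exact: measurable_unit_cube.
- by apply/measurable_EFinP; exact: measurable_funTS.
- by apply/measurable_EFinP; apply: measurable_funTS; exact: (measurable_labels G).
- by move=> t _; rewrite lee_fin.
- by move=> t _; rewrite lee_fin prodr_ge0.
pose E := [set p : mR * mR | I p.1 -> I p.2 -> kernel W p = M (c p.1) (c p.2)].
have mE : measurable E.
  have mM : measurable_fun setT (fun p : mR * mR => M (c p.1) (c p.2)).
    exact: measurable_label2.
  rewrite (_ : E = ~` II `|` (setT `&`
      [set p | kernel W p - M (c p.1) (c p.2) \in [set 0]]))%R.
    apply: measurableU; first by apply: measurableC; exact: measurable_unit_square.
    have mD : measurable_fun setT (fun p => kernel W p - M (c p.1) (c p.2))%R.
      by apply: measurable_realfun.measurable_funB => //; exact: measurable_kernel.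
    have := mD measurableT [set 0%R] (measurable_set1 0%R).
    by congr (measurable (_ `&` _)); apply/seteqP; split=> p /=; rewrite inE.
  rewrite setTI; apply/seteqP; split=> p; rewrite /E/= inE/=.
    have [[I1 I2] h|] := pselect (II p); last by left.
    by right; rewrite h// subrr.
  by case=> [nI I1 I2|/subr0_eq//]; case: nI.
have : {ae tl #|F|, forall t, forall e : F * F, cond e ->
    E (tnth t (enum_rank e.1), tnth t (enum_rank e.2))}.
  apply: filter_forall => e; case ce : (cond e); last by apply: ae_all.
  have rk : (enum_rank e.1 < enum_rank e.2)%N by case/andP: ce.
  by apply: ae_imp (ae_tnth_pair mE WM rk) => t Et _; exact: Et.
apply: ae_imp => t h It; congr EFin; apply: eq_bigr => e ce.
by rewrite !tnth_map; apply: (h e ce); exact: It.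

Qed.

End labelled.

(** * Uniqueness in the upper range *)

Section uniqueness.
Variable R : realType.
Local Notation mR := (measurableTypeR R).
Local Notation mu := (@lebesgue_measure R).
Local Notation I := (@unit_interval R).

Definition clique_label (S : set mR) (x : mR) : bool := x \in S.

Lemma measurable_clique_label (S : set mR) l :
  measurable S -> measurable [set x | clique_label S x = l].
Proof.
move=> mS; case: l.
  rewrite (_ : [set x | _] = S)//.
  by apply/seteqP; split=> x /=; [exact: set_mem|exact: mem_set].
rewrite (_ : [set x | _] = ~` S); first exact: measurableC.
apply/seteqP; split=> x /=; rewrite /clique_label.
  by move=> xS /mem_set; rewrite xS.
by move=> nS; exact: memNset.
Qed.

Lemma clique_label_mass (S : set mR) l : measurable S -> S `<=` I ->
  mu S = (2^-1)%:E -> label_mass (clique_label S) l = 2^-1.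
Proof.
move=> mS SI muS; have mI := @measurable_unit_interval R.
have -> : 2^-1 = fine (2^-1%:E : \bar R) by [].
congr fine; case: l.
  rewrite (_ : I `&` _ = S)//; apply/seteqP; split=> x /=.
    by move=> [_ /set_mem].
  by move=> Sx; split; [exact: SI|exact: mem_set].
have -> : I `&` [set x | clique_label S x = false] = I `\` S.
  apply/seteqP; split=> x /= [Ix]; rewrite /clique_label.
    by move=> xS; split=> // /mem_set; rewrite xS.
  by move=> nS; split=> //; exact: memNset.
have : mu I = (mu S + mu (I `\` S))%E.
  rewrite -{1}(setDUK SI) measureU//; first exact: measurableD.
  by rewrite setDE setICA setICr setI0.
rewrite [X in X = _ -> _]lebesgue_unit_interval [X in (X + _)%E]muS.
case: (mu (I `\` S)) => [r [e]||] //.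
by congr EFin; lra.
Qed.

(** The cliques [S1] and [S2] may differ as sets, but both graphons are described by the same matrix
    on two labels of mass 1/2. *)
Lemma optimal_equivalent (gamma : R) (W1 W2 : graphon R) :
  gamma0 R <= gamma < 1 ->
  feasible gamma W1 -> entropy W1 = (rstar gamma)%:E ->
  feasible gamma W2 -> entropy W2 = (rstar gamma)%:E -> equivalent W1 W2.
Proof.
move=> g01 [d1 c1] e1 [d2 c2] e2 F.
have [S1 [mS1 S1I muS1 W1E]] := optimal_two_cliques c1 d1 g01 e1.
have [S2 [mS2 S2I muS2 W2E]] := optimal_two_cliques c2 d2 g01 e2.
pose M (l k : bool) := if l == k then 1 else 2 * gamma - 1.
have M0 l k : 0 <= M l k.
  have /andP[s2 s3] := sqrt5_bounds R; have /andP[g0 _] := g01.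
  by rewrite /M; case: ifP => _ //; move: g0; rewrite gamma0E; lra.
rewrite (hom_density_labels (fun l => measurable_clique_label l mS1) M0 F W1E).
rewrite (hom_density_labels (fun l => measurable_clique_label l mS2) M0 F W2E).
by congr EFin; apply: eq_label_sum => // l; rewrite !clique_label_mass.
Qed.

End uniqueness.

(** * Disjoint unions of two extremal structures *)

Section two_pieces.
Variable R : realType.
Local Notation mR := (measurableTypeR R).
Local Notation mu := (@lebesgue_measure R).
Local Notation I := (@unit_interval R).
Variables a b q : R.
Hypotheses (a0 : 0 <= a) (b0 : 0 <= b) (ab1 : a + b <= 1) (q01 : 0 < q < 1).

(* Labels 0, 1 are the two cliques of the piece of size [a], labels 2, 3 those
   of the piece of size [b], and label 4 is the isolated remainder. *)
Definition piece_label (x : mR) : 'I_5 :=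
  if (x : R) < a / 2 then inord 0 else if (x : R) < a then inord 1
  else if (x : R) < a + b / 2 then inord 2 else if (x : R) < a + b then inord 3
  else inord 4.

(** Halving a label names its piece: 0 and 1 give 0, while 2 and 3 give 1. *)
Definition piece_weight (l k : 'I_5) : R :=
  if [|| l == 4 :> nat, k == 4 :> nat | l./2 != k./2] then 0
  else if l == k :> nat then 1 else q.

Lemma piece_weightC l k : piece_weight l k = piece_weight k l.
Proof.
by rewrite /piece_weight orbCA (eq_sym (nat_of_ord l) k) (eq_sym l./2).
Qed.

Lemma piece_weight01 l k : 0 <= piece_weight l k <= 1.
Proof.
have /andP[q_gt0 q_lt1] := q01.
by rewrite /piece_weight; case: ifP => _; [|case: ifP => _]; rewrite ?lexx ?ler01// !ltW.
Qed.

Definition piece_mass (l : 'I_5) : R :=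
  nth 0 [:: a / 2; a / 2; b / 2; b / 2; 1 - (a + b)] l.

Lemma piece_labelE (l : 'I_5) : I `&` [set x | piece_label x = l] =
  nth set0 [:: `[0, a / 2[; `[a / 2, a[; `[a, a + b / 2[; `[a + b / 2, a + b[;
    `[a + b, 1]]%classic l.
Proof.
apply/seteqP; split=> x /=.
  rewrite /unit_interval/= in_itv/= => -[/andP[x0 x1] <-]; rewrite /piece_label.
  by do ![case: ltP => ?]; rewrite inordK//= in_itv/=; apply/andP; split=> //; lra.
move: a0 b0 ab1 => a0' b0' ab1'.
case: l => -[|[|[|[|[|//]]]]] i5 /=; rewrite in_itv/= => /andP[h1 h2];
  (split; [by rewrite /unit_interval/= in_itv/=; apply/andP; split; lra|]);
  apply/val_inj; rewrite /piece_label; do ![case: ltP => ?];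
  rewrite /= ?inordK//; exfalso; lra.
Qed.

(** The label is determined by the truth values of four comparisons, so each class is a finite union
    of intersections of half-lines. *)
Lemma measurable_piece_label l : measurable [set x | piece_label x = l].
Proof.
have mlt (B : bool) (r : R) : measurable [set x : mR | ((x : R) < r) = B].
  have h : measurable_fun setT (fun x : mR => (x : R) < r).
    exact: measurable_fun_ltr.
  rewrite -[X in measurable X]setTI.
  exact: (h measurableT [set B]).
pose cut (b1 b2 b3 b4 : bool) : 'I_5 := if b1 then inord 0 else if b2 then inord 1
  else if b3 then inord 2 else if b4 then inord 3 else inord 4.
rewrite (_ : [set x | _] = \bigcup_(t in [set t : bool * bool * bool * bool |
    cut t.1.1.1 t.1.1.2 t.1.2 t.2 = l])
  ([set x : mR | ((x : R) < a / 2) = t.1.1.1] `&`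
   [set x : mR | ((x : R) < a) = t.1.1.2] `&`
   [set x : mR | ((x : R) < a + b / 2) = t.1.2] `&`
   [set x : mR | ((x : R) < a + b) = t.2])).
  apply: fin_bigcup_measurable => [|t _]; first exact: finite_finset.
  by apply: measurableI => //; apply: measurableI => //; exact: measurableI.
apply/seteqP; split=> x /=.
  by move=> xl; exists ((x : R) < a / 2, (x : R) < a, (x : R) < a + b / 2, (x : R) < a + b).
by move=> [[[[t1 t2] t3] t4]] /= <- [[[h1 h2] h3] h4]; rewrite /piece_label h1 h2 h3 h4.
Qed.

Lemma piece_label_mass l : label_mass piece_label l = piece_mass l.
Proof.
rewrite /label_mass piece_labelE /piece_mass.
have hlen (x y : R) b1 b2 : x <= y ->
    fine (mu [set` Interval (BSide b1 x) (BSide b2 y)]) = y - x.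
  move=> xy; rewrite lebesgue_measure_itv/= lte_fin.
  case: ltP => [//|yx]; rewrite (le_anti (introT andP (conj xy yx))) subrr//.
move: a0 b0 ab1 => a0' b0' ab1'.
by case: l => -[|[|[|[|[|//]]]]] i5 /=; rewrite hlen; lra.
Qed.

Definition two_pieces_fun (p : mR * mR) : R :=
  piece_weight (piece_label p.1) (piece_label p.2).

Lemma measurable_two_pieces : measurable_fun (@unit_square R) two_pieces_fun.
Proof.
apply: measurable_funTS.
exact: (measurable_label2 measurable_piece_label piece_weight).
Qed.

(** Sizes 1 and 0 give the optimal graphon of the upper range; two positive sizes are used in the
    lower range. *)
Definition two_pieces : graphon R := @Graphon R two_pieces_fun
  measurable_two_pieces (fun x y _ => piece_weightC _ _)
  (fun p _ => piece_weight01 _ _).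

Lemma edge_density_two_pieces :
  edge_density two_pieces = ((a ^+ 2 + b ^+ 2) * (1 + q) / 2)%:E.
Proof.
rewrite /edge_density (integral_label2 measurable_piece_label); last first.
  by move=> l k; case/andP: (piece_weight01 l k).
congr EFin; under eq_bigr do (rewrite piece_label_mass;
  under eq_bigr do rewrite piece_label_mass).
rewrite !big_ord_recl !big_ord0 /piece_mass /piece_weight/=.
by field.
Qed.

Lemma entropy_two_pieces :
  entropy two_pieces = ((a ^+ 2 + b ^+ 2) / 2 * binary_entropy q)%:E.
Proof.
rewrite /entropy (integral_label2 measurable_piece_label
  (g := fun l k => binary_entropy (piece_weight l k))); last first.
  by move=> l k; apply: binary_entropy_ge0; exact: piece_weight01.
congr EFin; under eq_bigr do (rewrite piece_label_mass;
  under eq_bigr do rewrite piece_label_mass).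
rewrite !big_ord_recl !big_ord0 /piece_mass /piece_weight/=.
rewrite binary_entropy0 binary_entropy1.
by field.
Qed.

(** Pigeonhole: leaves joined to the centre lie in its piece, which has only two labels, so two of
    the three leaves share a label and have weight 1. *)
Lemma piece_weight_claw i j k l :
  piece_weight i j * piece_weight i k * piece_weight i l *
  (1 - piece_weight j k) * (1 - piece_weight j l) * (1 - piece_weight k l) = 0.
Proof.
have nz (x y : 'I_5) : piece_weight x y != 0 -> y != 4 :> nat /\ x./2 = y./2.
  rewrite /piece_weight; case: ifP => [_|/negbT]; first by rewrite eqxx.
  by rewrite !negb_or negbK => /and3P[_ y4 /eqP xy].
have eq1 (x y : 'I_5) : x != 4 :> nat -> x = y :> nat -> 1 - piece_weight x y = 0.
  move=> x4 xy; rewrite /piece_weight -xy eqxx orbF (negbTE x4)/= eqxx.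
  by rewrite subrr.
have [->|/nz[j4 ij]] := eqVneq (piece_weight i j) 0; first by rewrite !mul0r.
have [->|/nz[k4 ik]] := eqVneq (piece_weight i k) 0; first by rewrite mulr0 !mul0r.
have [->|/nz[l4 il]] := eqVneq (piece_weight i l) 0; first by rewrite mulr0 !mul0r.
have [jk|jk] := eqVneq (j : nat) k; first by rewrite (eq1 _ _ j4 jk) mulr0 !mul0r.
have [jl|jl] := eqVneq (j : nat) l; first by rewrite (eq1 _ _ j4 jl) mulr0 !mul0r.
by rewrite (eq1 k l k4) ?mulr0//; move: ij ik il; lia.
Qed.

Lemma claw_density_two_pieces : claw_density two_pieces = 0%E.
Proof.
rewrite claw_density_kernel integral0_eq// => x _; congr EFin.
move: (tnth x (lift ord0 (lift ord0 (lift ord0 ord0)))) (tnth x (lift ord0 (lift ord0 ord0)))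
  (tnth x (lift ord0 ord0)) (tnth x ord0) => l k j i.
have z y z' : kernel two_pieces (y, z') != 0 -> I y /\ I z'.
  move=> h; split; first exact: kernel_supp h.
  by rewrite kernelC in h; exact: kernel_supp h.
rewrite /claw.
have [->|/z[Ii Ij]] := eqVneq (kernel two_pieces (i, j)) 0; first by rewrite !mul0r.
have [->|/z[_ Ik]] := eqVneq (kernel two_pieces (i, k)) 0; first by rewrite mulr0 !mul0r.
have [->|/z[_ Il]] := eqVneq (kernel two_pieces (i, l)) 0; first by rewrite mulr0 !mul0r.
rewrite !kernelE//; exact: piece_weight_claw.
Qed.

End two_pieces.

(** * The triangle density *)

Section triangle.

Lemma triangle_adj_sym : symmetric (fun i j : 'I_3 => i != j).
Proof. by move=> i j; rewrite eq_sym. Qed.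

Lemma triangle_adj_irrefl : irreflexive (fun i j : 'I_3 => i != j).
Proof. by move=> i; rewrite eqxx. Qed.

Definition triangle : sgraph := SGraph triangle_adj_sym triangle_adj_irrefl.

Variables (R : realType) (L : finType) (p : L -> R) (M : L -> L -> R).

Lemma label_sum_triangle :
  label_sum p (fun s : #|triangle|.-tuple L =>
    \prod_(e : triangle * triangle |
        adj e.1 e.2 && (enum_rank e.1 < enum_rank e.2)%N)
      M (tnth s (enum_rank e.1)) (tnth s (enum_rank e.2))) =
  \sum_i p i * \sum_j p j * \sum_k p k * (M i j * M i k * M j k).
Proof.
(* The number of vertices of [triangle] equals 3 but does not reduce to it. Generalizing it to [n],
   with [cast_ord] in place of [enum_rank], allows the equation to be eliminated. *)
have gen n (E : 3 = n) : label_sum p (fun s : n.-tuple L =>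
    \prod_(e : 'I_3 * 'I_3 | (e.1 != e.2) && (cast_ord E e.1 < cast_ord E e.2)%N)
      M (tnth s (cast_ord E e.1)) (tnth s (cast_ord E e.2))) =
    \sum_i p i * \sum_j p j * \sum_k p k * (M i j * M i k * M j k).
  case: n / E => /=.
  apply: eq_bigr => i _; congr (_ * _); apply: eq_bigr => j _; congr (_ * _).
  apply: eq_bigr => k _; congr (_ * _).
  under eq_bigr do rewrite !cast_ord_id.
  rewrite big_mkcond/= -(pair_bigA _ (fun x y : 'I_3 =>
    if (x != y) && (x < y)%N then M (tnth [tuple i; j; k] x) (tnth [tuple i; j; k] y)
    else 1))/=.
  rewrite !big_ord_recl !big_ord0 /= !(tnth_nth i) /=.
  by rewrite ?(mul1r, mulr1).
rewrite -(gen _ (esym (card_ord 3))); apply: eq_label_sum => // s.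
apply: eq_big => [e|e _]; rewrite !enum_rank_ord//.
Qed.

End triangle.

(** * Optimal graphons in both ranges *)

Section optimal_pieces.
Variable R : realType.

Lemma hom_density_triangle (a b q : R) (a0 : 0 <= a) (b0 : 0 <= b)
    (ab1 : a + b <= 1) (q01 : 0 < q < 1) :
  hom_density triangle (two_pieces a b q01) =
  ((a ^+ 3 + b ^+ 3) * ((1 + 3 * q ^+ 2) / 4))%:E.
Proof.
rewrite (hom_density_labels (measurable_piece_label a b)
  (fun l k => proj1 (andP (piece_weight01 q01 l k)))); last first.
  by apply: ae_all => x; apply: ae_all => y Ix Iy; rewrite kernelE.
congr EFin; rewrite label_sum_triangle.
under eq_bigr do (rewrite piece_label_mass//; under eq_bigr do
  (rewrite piece_label_mass//; under eq_bigr do rewrite piece_label_mass//)).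
rewrite !big_ord_recl !big_ord0 /piece_mass /piece_weight/=.
by field.
Qed.

(** Factor out [a - a'] and [b' - b]. The quotient of [x^2 + x y + y^2] by [x + y] is at most 3/2 of
    the larger number and at least 3/2 of the smaller. So it is at most [3/2 b'] for the pair [b],
    [b'] and more than that for [a], [a'], since [b' < a' < a]. *)
Lemma two_cubes_inj (a b a' b' : R) : 0 < b -> b < b' -> b' < a' ->
  a ^+ 2 + b ^+ 2 = a' ^+ 2 + b' ^+ 2 -> 0 < a ->
  a ^+ 3 + b ^+ 3 <> a' ^+ 3 + b' ^+ 3.
Proof.
move=> b0 bb' ba' e2 a0 e3.
have aa' : a' < a by nra.
have u0 : 0 < a - a' by lra.
have v0 : 0 < b' - b by lra.
have e2' : (a - a') * (a + a') = (b' - b) * (b' + b) by nra.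
have e3' : (a - a') * (a ^+ 2 + a * a' + a' ^+ 2) =
  (b' - b) * (b' ^+ 2 + b' * b + b ^+ 2) by nra.
have h1 : (b' - b) * (b' ^+ 2 + b' * b + b ^+ 2) <=
    (b' - b) * (b' + b) * (3 / 2 * b').
  by rewrite -mulrA ler_pM2l//; nra.
have h2 : (a - a') * (a + a') * (3 / 2 * b') < (a - a') * (a ^+ 2 + a * a' + a' ^+ 2).
  rewrite -mulrA ltr_pM2l//; apply: (@lt_trans _ _ ((a + a') * (3 / 2 * a'))).
    by rewrite ltr_pM2l; lra.
  nra.
by rewrite e3' e2' ltNge h1 in h2.
Qed.

Lemma two_pieces_feasible (a b q gamma : R) (a0 : 0 <= a) (b0 : 0 <= b)
    (ab1 : a + b <= 1) (q01 : 0 < q < 1) :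
  (a ^+ 2 + b ^+ 2) * (1 + q) / 2 = gamma -> feasible gamma (two_pieces a b q01).
Proof.
by move=> <-; split; [exact: edge_density_two_pieces|exact: claw_density_two_pieces].
Qed.

(** A single piece fills the interval; its density [(1 + q) / 2] equals [gamma] for
    [q = 2 gamma - 1]. *)
Lemma high_density_optimal (gamma : R) : gamma0 R <= gamma < 1 ->
  exists2 W : graphon R, feasible gamma W & entropy W = (rstar gamma)%:E.
Proof.
move=> /andP[g0 g1]; have /andP[s2 s3] := sqrt5_bounds R.
have q01 : 0 < 2 * gamma - 1 < 1.
  by move: g0; rewrite gamma0E => g0; apply/andP; split; lra.
have ab1 : (1 : R) + 0 <= 1 by rewrite addr0.
exists (two_pieces 1 0 q01).
  by apply: two_pieces_feasible => //; rewrite expr1n expr0n/=; lra.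
rewrite entropy_two_pieces//; congr EFin; rewrite /rstar ltNge g0/=.
by rewrite expr1n expr0n/= addr0 mul1r.
Qed.

(** Density and entropy of two pieces depend on the sizes only through [a^2 + b^2], which is kept at
    the value [c]. The sizes [b i] are distinct, so the sums of cubes, hence the triangle densities,
    differ. *)
Lemma low_density_optimal (gamma : R) : 0 < gamma < gamma0 R ->
  exists W : nat -> graphon R,
    (forall i, feasible gamma (W i) /\ entropy (W i) = (rstar gamma)%:E) /\
    (forall i j, i <> j -> ~ equivalent (W i) (W j)).
Proof.
move=> /andP[g_gt0 g_lt]; have /andP[s2 s3] := sqrt5_bounds R.
have s5 := sqrt5_sqr R.
pose q : R := (3 - Num.sqrt 5) / 2.
have q01 : 0 < q < 1 by rewrite /q; apply/andP; split; lra.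
have [q_gt0 q_lt1] := andP q01.
(* Solves [c (1 + q) / 2 = gamma]; it is below 1 because [gamma0 = (1 + q) / 2]. *)
pose c := 2 * gamma / (1 + q).
have c0 : 0 < c by rewrite divr_gt0//; lra.
have c1 : c < 1.
  by rewrite ltr_pdivrMr; [move: g_lt; rewrite gamma0E -/q|]; lra.
pose r := Num.sqrt c.
have r2 : r ^+ 2 = c by rewrite sqr_sqrtr// ltW.
have r0 : 0 < r by rewrite sqrtr_gt0.
have r1 : r < 1 by rewrite -sqrtr1 ltr_sqrt.
(* The bound [1 - r] ensures that both pieces fit, since [a i <= r]; the bound [r / 2] gives
   [b j ^ 2 <= c / 4], hence [b j < a i] for all [i] and [j]. *)
pose t := Num.min (1 - r) (r / 2).
have t0 : 0 < t by rewrite lt_min; apply/andP; split; lra.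
have t1 : t <= 1 - r by rewrite ge_min lexx.
have t2 : t <= r / 2 by rewrite ge_min lexx orbT.
pose b (i : nat) := t / i.+1%:R.
have b0 i : 0 < b i by rewrite divr_gt0// ltr0n.
have bt i : b i <= t.
  by rewrite ler_pdivrMr ?ltr0n// ler_peMr ?ler1n// ltW.
pose a i := Num.sqrt (c - b i ^+ 2).
have b2 i : b i ^+ 2 <= c / 4.
  by have := bt i; have := b0 i; rewrite -r2; nra.
have a2 i : a i ^+ 2 = c - b i ^+ 2 by rewrite sqr_sqrtr//; have := b2 i; lra.
have a0 i : 0 < a i by rewrite sqrtr_gt0; have := b2 i; lra.
have ar i : a i <= r.
  by rewrite ler_sqrt//; have := sqr_ge0 (b i); lra.
have ab1 i : a i + b i <= 1 by have := ar i; have := bt i; lra.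
have lt_ba i j : b j < a i.
  rewrite -(@ltr_pXn2r _ 2) ?nnegrE ?ltW//.
  by rewrite a2; have := b2 i; have := b2 j; lra.
pose W i := two_pieces (a i) (b i) q01.
have Wf i : feasible gamma (W i).
  apply: two_pieces_feasible => //; try exact: ltW.
  by rewrite a2 subrK /c; field; rewrite gt_eqF//; lra.
have We i : entropy (W i) = (rstar gamma)%:E.
  rewrite (entropy_two_pieces (ltW (a0 i)) (ltW (b0 i)) (ab1 i)).
  congr EFin; rewrite /rstar g_lt a2 subrK -/q.
  (* The entropy is [c / 2] times that of [q], and [c / 2 = gamma / (1 + q)]. *)
  suff -> : (5 + Num.sqrt 5) / 10 = 1 / (1 + q) by rewrite /c; field; rewrite gt_eqF//; lra.
  have q1 : 1 + q != 0 by rewrite gt_eqF//; lra.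
  apply: (mulIf q1); rewrite divfK// /q.
  transitivity ((25 - Num.sqrt 5 ^+ 2) / 20 : R); first by field.
  by rewrite s5; field.
exists W; split=> // i j ij /(_ triangle).
rewrite (hom_density_triangle (ltW (a0 i)) (ltW (b0 i)) (ab1 i)).
rewrite (hom_density_triangle (ltW (a0 j)) (ltW (b0 j)) (ab1 j)) => -[].
have K0 : (1 + 3 * q ^+ 2) / 4 != 0 by rewrite gt_eqF//; have := sqr_ge0 q; lra.
move/(mulIf K0).
have bij : b i != b j.
  apply/eqP => /(mulfI (lt0r_neq0 t0)) /invr_inj /eqP.
  by rewrite eqr_nat eqSS => /eqP.
have e2 : a i ^+ 2 + b i ^+ 2 = a j ^+ 2 + b j ^+ 2 by rewrite !a2 !subrK.
have [bb|bb|/eqP] := ltgtP (b i) (b j); last by rewrite (negbTE bij).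
  exact: two_cubes_inj.
by move/esym; exact: two_cubes_inj.
Qed.

Lemma phi_rstar (gamma : R) : 0 < gamma < 1 -> phi gamma = (rstar gamma)%:E.
Proof.
move=> g01; apply: le_anti; apply/andP; split.
  by apply: ub_ereal_sup => _ [W [Wd Wc] <-]; exact: entropy_le_rstar.
have [W Wf We] : exists2 W : graphon R, feasible gamma W & entropy W = (rstar gamma)%:E.
  have [g|g] := ltP gamma (gamma0 R); last first.
    by apply: high_density_optimal; rewrite g; case/andP: g01.
  have [|W [+ _]] := @low_density_optimal gamma.
    by rewrite g andbT; case/andP: g01.
  by move=> /(_ 0)[]; exists (W 0).
by rewrite -We; apply: ereal_sup_ubound; exists W.
Qed.

End optimal_pieces.

Theorem theorem1p3 (R : realType) :
  (forall gamma : R, 0 < gamma < 1 -> phi gamma = (rstar gamma)%:E) /\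
  (forall gamma : R, gamma0 R <= gamma < 1 ->
     (exists W : graphon R, achieves gamma W) /\
     (forall W1 W2 : graphon R,
        achieves gamma W1 -> achieves gamma W2 -> equivalent W1 W2)) /\
  (forall gamma : R, 0 < gamma < gamma0 R ->
     exists W : nat -> graphon R,
       (forall i, achieves gamma (W i)) /\
       (forall i j, i <> j -> ~ equivalent (W i) (W j))).
Proof.
have /andP[s2 s3] := sqrt5_bounds R.
split; first exact: phi_rstar.
split=> gamma g.
  have phiE : phi gamma = (rstar gamma)%:E.
    by apply: phi_rstar; move: g; rewrite gamma0E => /andP[g0 g1]; apply/andP; split; lra.
  split.
    by have [W Wf We] := high_density_optimal g; exists W; split=> //; rewrite phiE.
  move=> W1 W2 [f1 e1] [f2 e2]; rewrite phiE in e1 e2.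
  exact: optimal_equivalent g f1 e1 f2 e2.
have phiE : phi gamma = (rstar gamma)%:E.
  by apply: phi_rstar; move: g; rewrite gamma0E => /andP[g0 g1]; apply/andP; split; lra.
have [W [Wopt Wneq]] := low_density_optimal g.
by exists W; split=> // i; have [f e] := Wopt i; split=> //; rewrite phiE.
Qed.
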